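(* Let $\mathcal{A}$ and $\mathcal{B}$ be abelian categories and let $\mathbf{F}:\mathcal{A}\to\mathcal{B}$ be an additive, right exact functor which is perfect. Then there exists a left recollement of $\underline{\mathcal{GP}((\mathbf{F},\mathcal{B}))}$ relative to $\underline{\mathcal{GP}(\mathcal{B})}$ and $\underline{\mathcal{GP}(\mathcal{A})}$, with functors $$i^{*}:\underline{\mathcal{GP}((\mathbf{F},\mathcal{B}))}\to\underline{\mathcal{GP}(\mathcal{B})},\quad i_{*}:\underline{\mathcal{GP}(\mathcal{B})}\to\underline{\mathcal{GP}((\mathbf{F},\mathcal{B}))},$$ $$j_{!}:\underline{\mathcal{GP}(\mathcal{A})}\to\underline{\mathcal{GP}((\mathbf{F},\mathcal{B}))},\quad j^{*}:\underline{\mathcal{GP}((\mathbf{F},\mathcal{B}))}\to\underline{\mathcal{GP}(\mathcal{A})}.$$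
   Context: Left comma category: for an additive functor $\mathbf{F}:\mathcal{A}\to\mathcal{B}$ between abelian categories, the objects of $(\mathbf{F},\mathcal{B})$ are $\binom{A}{B}_{\phi}$ with $A\in\mathcal{A}$, $B\in\mathcal{B}$ and $\phi\in\operatorname{Hom}_{\mathcal{B}}(\mathbf{F}A,B)$; a morphism $\binom{A}{B}_{\phi}\to\binom{A'}{B'}_{\phi'}$ is a pair $\binom{\alpha}{\beta}$ with $\alpha:A\to A'$ in $\mathcal{A}$, $\beta:B\to B'$ in $\mathcal{B}$ and $\beta\phi=\phi'\,\mathbf{F}(\alpha)$. If $\mathbf{F}$ is right exact, $(\mathbf{F},\mathcal{B})$ is abelian. Gorenstein projective objects: for an abelian category $\mathcal{C}$, $\mathcal{P}(\mathcal{C})$ is the full subcategory of projective objects. A complete $\mathcal{C}$-projective resolution is an exact sequence $\cdots\to Q_1\to Q_0\to Q^0\to Q^1\to\cdots$ of projective objects of $\mathcal{C}$ that remains exact after applying $\operatorname{Hom}_{\mathcal{C}}(-,P)$ for every $P\in\mathcal{P}(\mathcal{C})$. An object $G$ is Gorenstein projective if $G\cong\operatorname{Im}(Q_0\to Q^0)$ for some such sequence. $\mathcal{GP}(\mathcal{C})$ is the full subcategory of Gorenstein projective objects. It is a Frobenius category in which the objects of $\mathcal{P}(\mathcal{C})$ are the projective-injective objects, and $\underline{\mathcal{GP}(\mathcal{C})}$ is its stable category modulo $\mathcal{P}(\mathcal{C})$ (morphisms modulo those factoring through a projective object), which is a triangulated category. Perfect functor: $\mathbf{F}$ is perfect if (P1)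 for every exact sequence (unbounded complex) $Q^{\bullet}$ of projective objects in $\mathcal{A}$, $\mathbf{F}Q^{\bullet}$ is exact; and (P2) for every complete $\mathcal{B}$-projective resolution $P^{\bullet}$ and every $Q\in\mathcal{P}(\mathcal{A})$, $\operatorname{Hom}_{\mathcal{B}}(P^{\bullet},\mathbf{F}Q)$ is exact. Left recollement: for triangulated categories $\mathcal{C}',\mathcal{C},\mathcal{C}''$, a left recollement of $\mathcal{C}$ relative to $\mathcal{C}'$ and $\mathcal{C}''$ consists of exact (triangle) functors $i^{*}:\mathcal{C}\to\mathcal{C}'$, $i_{*}:\mathcal{C}'\to\mathcal{C}$, $j_{!}:\mathcal{C}''\to\mathcal{C}$, $j^{*}:\mathcal{C}\to\mathcal{C}''$ such that: $(i^{*},i_{*})$ and $(j_{!},j^{*})$ are adjoint pairs (left adjoint written first); $i_{*}$ and $j_{!}$ are fully faithful; $j^{*}i_{*}=0$; and for every $X\in\mathcal{C}$ the counit $\epsilon_X$ and unit $\eta_X$ give rise to a distinguished triangle $j_{!}j^{*}(X)\xrightarrow{\epsilon_X}X\xrightarrow{\eta_X}i_{*}i^{*}(X)\to j_{!}j^{*}(X)[1]$. *)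

(* Defs.v *)
From HB Require Import structures.
From mathcomp Require Import all_boot all_algebra.
From mathcomp Require Import boolp.

Set Implicit Arguments.
Unset Strict Implicit.
Unset Printing Implicit Defensive.

Import GRing.Theory.
Local Open Scope ring_scope.
Local Open Scope quotient_scope.

Reserved Notation "g ∘ f" (at level 40, left associativity).

(* Every category below is preadditive. The choice structure contained in
   zmodType is no restriction, since classical axioms provide it for any type. *)
Record preadditive := Preadditive {
  obj :> Type;
  hom : obj -> obj -> zmodType;
  idm : forall X, hom X X;
  comp : forall X Y Z, hom Y Z -> hom X Y -> hom X Z;
  compA : forall X Y Z W (h : hom Z W) (g : hom Y Z) (f : hom X Y),
    comp h (comp g f) = comp (comp h g) f;
  comp1m : forall X Y (f : hom X Y), comp (idm Y) f = f;
  compm1 : forall X Y (f : hom X Y), comp f (idm X) = f;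
  compDl : forall X Y Z (g g' : hom Y Z) (f : hom X Y),
    comp (g + g') f = comp g f + comp g' f;
  compDr : forall X Y Z (g : hom Y Z) (f f' : hom X Y),
    comp g (f + f') = comp g f + comp g f'
}.

Arguments hom {p} X Y.
Arguments idm {p} X.
Notation "g ∘ f" := (comp g f).

Section PreadditiveTheory.
Variable C : preadditive.
Implicit Types X Y Z : C.

Definition mono X Y (f : hom X Y) :=
  forall T (u v : hom T X), f ∘ u = f ∘ v -> u = v.

Definition epi X Y (f : hom X Y) :=
  forall T (u v : hom Y T), u ∘ f = v ∘ f -> u = v.

Definition is_iso X Y (f : hom X Y) :=
  exists g : hom Y X, g ∘ f = idm X /\ f ∘ g = idm Y.

Definition isomorphic X Y := exists f : hom X Y, is_iso f.

Definition is_kernel X Y (f : hom X Y) K (k : hom K X) :=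
  f ∘ k = 0 /\
  forall T (t : hom T X), f ∘ t = 0 -> exists! s : hom T K, k ∘ s = t.

Definition is_cokernel X Y (f : hom X Y) K (c : hom Y K) :=
  c ∘ f = 0 /\
  forall T (t : hom Y T), t ∘ f = 0 -> exists! s : hom K T, s ∘ c = t.

Definition is_image X Y (f : hom X Y) I (m : hom I Y) :=
  exists K (c : hom Y K), is_cokernel f c /\ is_kernel c m.

Definition is_zero X := idm X = 0.

Definition is_biproduct X Y S (i1 : hom X S) (i2 : hom Y S)
    (p1 : hom S X) (p2 : hom S Y) :=
  [/\ p1 ∘ i1 = idm X, p2 ∘ i2 = idm Y, p1 ∘ i2 = 0, p2 ∘ i1 = 0
    & i1 ∘ p1 + i2 ∘ p2 = idm S].

Definition projective P :=
  forall X Y (e : hom X Y) (f : hom P Y),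
    epi e -> exists g : hom P X, e ∘ g = f.

(* Im f = Ker g, as subobjects of Y *)
Definition exact X Y Z (f : hom X Y) (g : hom Y Z) :=
  exists I (m : hom I Y), is_image f m /\ is_kernel g m.

Definition short_exact X Y Z (f : hom X Y) (g : hom Y Z) :=
  is_kernel g f /\ is_cokernel f g.

End PreadditiveTheory.

Definition abelian (C : preadditive) : Prop :=
  [/\ exists X : C, is_zero X,
      forall X Y : C, exists S (i1 : hom X S) (i2 : hom Y S) p1 p2,
        is_biproduct i1 i2 p1 p2,
      (forall (X Y : C) (f : hom X Y), exists K (k : hom K X), is_kernel f k)
      /\ (forall (X Y : C) (f : hom X Y), exists K (c : hom Y K), is_cokernel f c),
      forall (X Y : C) (f : hom X Y), mono f ->
        exists Z (g : hom Y Z), is_kernel g f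
    & forall (X Y : C) (f : hom X Y), epi f ->
        exists Z (g : hom Z X), is_cokernel g f].

Record abcat := AbCat { abcat_cat :> preadditive; abcatP : abelian abcat_cat }.

Record addfun (C D : preadditive) := AddFun {
  fobj :> C -> D;
  fmap : forall X Y, hom X Y -> hom (fobj X) (fobj Y);
  fmap1 : forall X, fmap (idm X) = idm (fobj X);
  fmapM : forall X Y Z (g : hom Y Z) (f : hom X Y),
    fmap (g ∘ f) = fmap g ∘ fmap f;
  fmapD : forall X Y (f g : hom X Y), fmap (f + g) = fmap f + fmap g
}.

Arguments fmap {C D} F {X Y} f : rename.

Definition right_exact (C D : preadditive) (F : addfun C D) :=
  forall (X Y Z : C) (f : hom X Y) (g : hom Y Z), exact f g -> epi g ->
    exact (fmap F f) (fmap F g) /\ epi (fmap F g).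

Section ElementaryLemmas.
Variable C : preadditive.
Implicit Types X Y Z : C.

Lemma comp0m X Y Z (f : hom X Y) : (0 : hom Y Z) ∘ f = 0.
Proof. by apply: (addrI (0 ∘ f)); rewrite -compDl !addr0. Qed.

Lemma compm0 X Y Z (f : hom Y Z) : f ∘ (0 : hom X Y) = 0.
Proof. by apply: (addrI (f ∘ 0)); rewrite -compDr !addr0. Qed.

Lemma compNl X Y Z (g : hom Y Z) (f : hom X Y) : (- g) ∘ f = - (g ∘ f).
Proof. by apply: (addrI (g ∘ f)); rewrite -compDl !subrr comp0m. Qed.

Lemma compNr X Y Z (g : hom Y Z) (f : hom X Y) : g ∘ (- f) = - (g ∘ f).
Proof. by apply: (addrI (g ∘ f)); rewrite -compDr !subrr compm0. Qed.

Lemma compBl X Y Z (g g' : hom Y Z) (f : hom X Y) :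
  (g - g') ∘ f = g ∘ f - g' ∘ f.
Proof. by rewrite compDl compNl. Qed.

Lemma compBr X Y Z (g : hom Y Z) (f f' : hom X Y) :
  g ∘ (f - f') = g ∘ f - g ∘ f'.
Proof. by rewrite compDr compNr. Qed.

Lemma monoP X Y (f : hom X Y) :
  (forall T (u : hom T X), f ∘ u = 0 -> u = 0) -> mono f.
Proof.
move=> h T u v e; apply/eqP; rewrite -subr_eq0; apply/eqP/h.
by rewrite compBr e subrr.
Qed.

Lemma mono0 X Y (f : hom X Y) T (u : hom T X) : mono f -> f ∘ u = 0 -> u = 0.
Proof. by move=> h e; apply: h; rewrite e compm0. Qed.

Lemma epiP X Y (f : hom X Y) :
  (forall T (u : hom Y T), u ∘ f = 0 -> u = 0) -> epi f.
Proof.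
move=> h T u v e; apply/eqP; rewrite -subr_eq0; apply/eqP/h.
by rewrite compBl e subrr.
Qed.

Lemma epi0 X Y (f : hom X Y) T (u : hom Y T) : epi f -> u ∘ f = 0 -> u = 0.
Proof. by move=> h e; apply: h; rewrite e comp0m. Qed.

Lemma kernel_mono X Y (f : hom X Y) K (k : hom K X) : is_kernel f k -> mono k.
Proof.
move=> [fk h] T u v e; have [] := h T (k ∘ u) _; first by rewrite compA fk comp0m.
by move=> s [_ us]; rewrite -(us u) // -(us v).
Qed.

Lemma cokernel_epi X Y (f : hom X Y) K (c : hom Y K) : is_cokernel f c -> epi c.
Proof.
move=> [cf h] T u v e; have [] := h T (u ∘ c) _; first by rewrite -compA cf compm0.
by move=> s [_ us]; rewrite -(us u) // -(us v).
Qed.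

Lemma kernel_lift X Y (f : hom X Y) K (k : hom K X) T (t : hom T X) :
  is_kernel f k -> f ∘ t = 0 -> exists s, k ∘ s = t.
Proof. by move=> [_ h] /h [s [e _]]; exists s. Qed.

Lemma cokernel_lift X Y (f : hom X Y) K (c : hom Y K) T (t : hom Y T) :
  is_cokernel f c -> t ∘ f = 0 -> exists s, s ∘ c = t.
Proof. by move=> [_ h] /h [s [e _]]; exists s. Qed.

Lemma is_kernelP X Y (f : hom X Y) K (k : hom K X) :
  f ∘ k = 0 -> mono k ->
  (forall T (t : hom T X), f ∘ t = 0 -> exists s, k ∘ s = t) -> is_kernel f k.
Proof.
move=> fk mk h; split=> // T t /h [s e]; exists s; split=> // s' e'.
by apply: mk; rewrite e e'.
Qed.

Lemma is_cokernelP X Y (f : hom X Y) K (c : hom Y K) :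
  c ∘ f = 0 -> epi c ->
  (forall T (t : hom Y T), t ∘ f = 0 -> exists s, s ∘ c = t) -> is_cokernel f c.
Proof.
move=> fk mk h; split=> // T t /h [s e]; exists s; split=> // s' e'.
by apply: mk; rewrite e e'.
Qed.

Lemma mono_comp X Y Z (g : hom Y Z) (f : hom X Y) : mono g -> mono f -> mono (g ∘ f).
Proof. by move=> hg hf T u v; rewrite -!compA => /hg /hf. Qed.

Lemma epi_comp X Y Z (g : hom Y Z) (f : hom X Y) : epi g -> epi f -> epi (g ∘ f).
Proof. by move=> hg hf T u v; rewrite !compA => /hf /hg. Qed.

Lemma mono_kernel_comp X Y Z W (f : hom X Y) (m : hom Y Z) (k : hom W X) :
  mono m -> is_kernel (m ∘ f) k <-> is_kernel f k.
Proof.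
move=> mm; split=> -[h1 h2]; split.
- by apply: (mono0 mm); rewrite compA.
- by move=> T t ft; apply: h2; rewrite -compA ft compm0.
- by rewrite -compA h1 compm0.
- by move=> T t; rewrite -compA => /(mono0 mm); apply: h2.
Qed.

Lemma epi_of_kernel X Y (f : hom X Y) K (k : hom K X) Z (g : hom Z X) :
  is_kernel f k -> is_cokernel g f -> is_cokernel k f.
Proof.
move=> kk cg; apply: is_cokernelP; [by case: kk|exact: cokernel_epi cg|].
move=> T t tk; apply: (cokernel_lift cg); have [s <-] := kernel_lift kk cg.1.
by rewrite compA tk comp0m.
Qed.

Lemma mono_of_cokernel X Y (f : hom X Y) K (c : hom Y K) Z (g : hom Y Z) :
  is_cokernel f c -> is_kernel g f -> is_kernel c f.
Proof.
move=> kk cg; apply: is_kernelP; [by case: kk|exact: kernel_mono cg|].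
move=> T t tk; apply: (kernel_lift cg); have [s <-] := cokernel_lift kk cg.1.
by rewrite -compA tk compm0.
Qed.

Lemma iso_mono X Y (f : hom X Y) : is_iso f -> mono f.
Proof. by move=> [g [e _]] T u v E; rewrite -(comp1m u) -(comp1m v) -e -!compA E. Qed.

Lemma iso_epi X Y (f : hom X Y) : is_iso f -> epi f.
Proof. by move=> [g [_ e]] T u v E; rewrite -(compm1 u) -(compm1 v) -e !compA E. Qed.

Lemma kernel_unique X Y (f : hom X Y) K (k : hom K X) K' (k' : hom K' X) :
  is_kernel f k -> is_kernel f k' -> exists s : hom K K', is_iso s /\ k' ∘ s = k.
Proof.
move=> h h'; have [s e] := kernel_lift h' h.1; have [s' e'] := kernel_lift h h'.1.
exists s; split=> //; exists s'; split.
  by apply: (kernel_mono h); rewrite compA e' e compm1.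
by apply: (kernel_mono h'); rewrite compA e e' compm1.
Qed.

Lemma kernel_iso X Y (f : hom X Y) K (k : hom K X) K' (s : hom K' K) :
  is_iso s -> is_kernel f k -> is_kernel f (k ∘ s).
Proof.
move=> hs hk; apply: is_kernelP.
- by rewrite compA hk.1 comp0m.
- by apply: mono_comp (kernel_mono hk) (iso_mono hs).
- move=> T t /(kernel_lift hk) [r <-]; have [s' [_ e]] := hs.
  by exists (s' ∘ r); rewrite -compA [s ∘ (_ ∘ _)]compA e comp1m.
Qed.

Lemma cokernel_unique X Y (f : hom X Y) K (k : hom Y K) K' (k' : hom Y K') :
  is_cokernel f k -> is_cokernel f k' -> exists s : hom K K', is_iso s /\ s ∘ k = k'.
Proof.
move=> h h'; have [s e] := cokernel_lift h h'.1; have [s' e'] := cokernel_lift h' h.1.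
exists s; split=> //; exists s'; split.
  by apply: (cokernel_epi h); rewrite -compA e e' comp1m.
by apply: (cokernel_epi h'); rewrite -compA e' e comp1m.
Qed.

Lemma image_unique X Y (f : hom X Y) I (m : hom I Y) I' (m' : hom I' Y) :
  is_image f m -> is_image f m' -> exists s : hom I I', is_iso s /\ m' ∘ s = m.
Proof.
move=> [K [c [hc hm]]] [K' [c' [hc' hm']]].
have [s [hs e]] := cokernel_unique hc hc'.
have : is_kernel (s ∘ c) m by apply/(mono_kernel_comp c m (iso_mono hs)).
by rewrite e => h; apply: kernel_unique h hm'.
Qed.

Lemma image_mono X Y (f : hom X Y) I (m : hom I Y) : is_image f m -> mono m.
Proof. by case=> K [c [_ /kernel_mono]]. Qed.

Lemma exact0 X Y Z (f : hom X Y) (g : hom Y Z) : exact f g -> g ∘ f = 0.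
Proof.
move=> [I [m [[K [c [hc hm]]] hg]]]; have [s <-] := kernel_lift hm hc.1.
by rewrite compA hg.1 comp0m.
Qed.

Lemma exact_image_kernel X Y Z (f : hom X Y) (g : hom Y Z) I (m : hom I Y) :
  exact f g -> is_image f m -> is_kernel g m.
Proof.
move=> [I' [m' [h' k']]] h; have [s [hs <-]] := image_unique h h'.
exact: kernel_iso.
Qed.

End ElementaryLemmas.

Section AbelianLemmas.
Variable C : preadditive.
Hypothesis abC : abelian C.
Implicit Types X Y Z : C.

Lemma ab_kernel X Y (f : hom X Y) : exists K (k : hom K X), is_kernel f k.
Proof. by have [_ _ [h _] _ _] := abC; apply: h. Qed.

Lemma ab_cokernel X Y (f : hom X Y) : exists K (k : hom Y K), is_cokernel f k.
Proof. by have [_ _ [_ h] _ _] := abC; apply: h. Qed.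

Lemma ab_image X Y (f : hom X Y) : exists I (m : hom I Y), is_image f m.
Proof.
have [K [c hc]] := ab_cokernel f; have [I [m hm]] := ab_kernel c.
by exists I, m, K, c.
Qed.

Lemma ab_mono X Y (f : hom X Y) K (c : hom Y K) :
  mono f -> is_cokernel f c -> is_kernel c f.
Proof.
have [_ _ _ h _] := abC; move=> /h [Z [g hg]] hc.
exact: mono_of_cokernel hc hg.
Qed.

Lemma ab_epi X Y (f : hom X Y) K (k : hom K X) :
  epi f -> is_kernel f k -> is_cokernel k f.
Proof.
have [_ _ _ _ h] := abC; move=> /h [Z [g hg]] hc.
exact: epi_of_kernel hc hg.
Qed.

Lemma image_factor X Y (f : hom X Y) I (m : hom I Y) :
  is_image f m -> exists e : hom X I, epi e /\ m ∘ e = f.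
Proof.
move=> him; have mm := image_mono him.
have [K [c [hc hm]]] := him; have [e fe] := kernel_lift hm hc.1.
exists e; split=> //; apply: epiP => T u ue.
have [L [k hk]] := ab_kernel u; have [e' ee'] := kernel_lift hk ue.
have mmk : mono (m ∘ k) := mono_comp mm (kernel_mono hk).
have [Z [w hw]] := ab_cokernel (m ∘ k); have kw := ab_mono mmk hw.
have wf : w ∘ f = 0 by rewrite -fe -ee' !compA -(compA w) kw.1 comp0m.
have [w' ew'] := cokernel_lift hc wf.
have [s es] : exists s, (m ∘ k) ∘ s = m.
  by apply: (kernel_lift kw); rewrite -ew' -compA hm.1 compm0.
have ks : k ∘ s = idm I by apply: mm; rewrite compm1 compA.
by rewrite -(compm1 u) -ks compA hk.1 comp0m.
Qed.

Lemma image_epi_mono X Y (f : hom X Y) I (m : hom I Y) (e : hom X I) :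
  mono m -> epi e -> m ∘ e = f -> is_image f m.
Proof.
move=> mm ee fe; have [K [c hc]] := ab_cokernel f; exists K, c; split=> //.
apply: ab_mono => //; apply: is_cokernelP; last 1 first.
- by move=> T t tm; apply: (cokernel_lift hc); rewrite -fe compA tm comp0m.
- by apply: (epi0 ee); rewrite -compA fe hc.1.
- exact: cokernel_epi hc.
Qed.

Lemma exact_epi_cokernel X Y Z (f : hom X Y) (g : hom Y Z) :
  (exact f g /\ epi g) <-> is_cokernel f g.
Proof.
split=> [[[I [m [im km]]] eg]|hg].
  have [e [ee me]] := image_factor im; have cg := ab_epi eg km.
  apply: is_cokernelP => //; first by rewrite -me compA km.1 comp0m.
  move=> T t tf; apply: (cokernel_lift cg); apply: (epi0 ee).
  by rewrite -compA me.
split; last exact: cokernel_epi hg.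
by have [I [m hm]] := ab_kernel g; exists I, m; split=> //; exists Z, g.
Qed.

End AbelianLemmas.

Lemma fmap0 (C D : preadditive) (F : addfun C D) (X Y : C) :
  fmap F (0 : hom X Y) = 0.
Proof. by apply: (addrI (fmap F 0)); rewrite -fmapD !addr0. Qed.

Lemma fmapN (C D : preadditive) (F : addfun C D) (X Y : C) (f : hom X Y) :
  fmap F (- f) = - fmap F f.
Proof. by apply: (addrI (fmap F f)); rewrite -fmapD !subrr fmap0. Qed.

Lemma fmapB (C D : preadditive) (F : addfun C D) (X Y : C) (f g : hom X Y) :
  fmap F (f - g) = fmap F f - fmap F g.
Proof. by rewrite fmapD fmapN. Qed.

Section Comma.
Variables (A B : preadditive) (F : addfun A B).

Record comma_obj := CommaObj {
  cfst : A;
  csnd : B;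
  cmap : hom (F cfst) csnd
}.

Definition comma_square (X Y : comma_obj) :
    {pred (hom (cfst X) (cfst Y) * hom (csnd X) (csnd Y))%type} :=
  fun ab => ab.2 ∘ cmap X == cmap Y ∘ fmap F ab.1.

Lemma comma_square_zmod_closed X Y : zmod_closed (@comma_square X Y).
Proof.
split; first by rewrite unfold_in /= fmap0 compm0 comp0m.
move=> x y; rewrite !unfold_in /= => /eqP ex /eqP ey.
by rewrite fmapB compBr compBl ex ey.
Qed.

HB.instance Definition _ X Y :=
  GRing.isZmodClosed.Build _ (@comma_square X Y)
    (@comma_square_zmod_closed X Y).

Record comma_hom (X Y : comma_obj) := CommaHom {
  chom_val : (hom (cfst X) (cfst Y) * hom (csnd X) (csnd Y))%type;
  _ : chom_val \in comma_square (X := X) (Y := Y)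
}.

HB.instance Definition _ X Y := [isSub for @chom_val X Y].
HB.instance Definition _ X Y := [Choice of comma_hom X Y by <:].
HB.instance Definition _ X Y :=
  [SubChoice_isSubZmodule of comma_hom X Y by <:].

Implicit Types X Y Z W : comma_obj.

Definition hfst X Y (f : comma_hom X Y) := (chom_val f).1.
Definition hsnd X Y (f : comma_hom X Y) := (chom_val f).2.

Lemma comma_sq X Y (f : comma_hom X Y) :
  hsnd f ∘ cmap X = cmap Y ∘ fmap F (hfst f).
Proof. by case: f => f fP; apply/eqP. Qed.

Lemma comma_eq X Y (f g : comma_hom X Y) :
  hfst f = hfst g -> hsnd f = hsnd g -> f = g.
Proof.
move=> e1 e2; apply: val_inj; move: e1 e2; rewrite /hfst /hsnd /=.
by case: (chom_val f) (chom_val g) => [a b] [a' b'] /= -> ->.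
Qed.

Lemma mk_comma_subproof X Y (a : hom (cfst X) (cfst Y)) (b : hom (csnd X) (csnd Y)) :
  b ∘ cmap X = cmap Y ∘ fmap F a -> (a, b) \in comma_square (X := X) (Y := Y).
Proof. by move=> e; apply/eqP. Qed.

Definition mk_comma X Y a b (e : b ∘ cmap X = cmap Y ∘ fmap F a) : comma_hom X Y :=
  CommaHom (mk_comma_subproof e).

Lemma hfstD X Y (f g : comma_hom X Y) : hfst (f + g) = hfst f + hfst g.
Proof. by []. Qed.
Lemma hsndD X Y (f g : comma_hom X Y) : hsnd (f + g) = hsnd f + hsnd g.
Proof. by []. Qed.
Lemma hfst0 X Y : hfst (0 : comma_hom X Y) = 0.
Proof. by []. Qed.
Lemma hsnd0 X Y : hsnd (0 : comma_hom X Y) = 0.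
Proof. by []. Qed.

Lemma comma_id_subproof X : idm (csnd X) ∘ cmap X = cmap X ∘ fmap F (idm (cfst X)).
Proof. by rewrite fmap1 comp1m compm1. Qed.

Definition comma_id X : comma_hom X X := mk_comma (comma_id_subproof X).

Lemma comma_comp_subproof X Y Z (g : comma_hom Y Z) (f : comma_hom X Y) :
  (hsnd g ∘ hsnd f) ∘ cmap X = cmap Z ∘ fmap F (hfst g ∘ hfst f).
Proof. by rewrite -compA comma_sq compA comma_sq -compA fmapM. Qed.

Definition comma_comp X Y Z (g : comma_hom Y Z) (f : comma_hom X Y) :
  comma_hom X Z := mk_comma (comma_comp_subproof g f).

Lemma comma_compA X Y Z W (h : comma_hom Z W) (g : comma_hom Y Z)
  (f : comma_hom X Y) :
  comma_comp h (comma_comp g f) = comma_comp (comma_comp h g) f.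
Proof. by apply: comma_eq; apply: compA. Qed.

Lemma comma_comp1m X Y (f : comma_hom X Y) : comma_comp (comma_id Y) f = f.
Proof. by apply: comma_eq; apply: comp1m. Qed.

Lemma comma_compm1 X Y (f : comma_hom X Y) : comma_comp f (comma_id X) = f.
Proof. by apply: comma_eq; apply: compm1. Qed.

Lemma comma_compDl X Y Z (g g' : comma_hom Y Z) (f : comma_hom X Y) :
  comma_comp (g + g') f = comma_comp g f + comma_comp g' f.
Proof. by apply: comma_eq; apply: compDl. Qed.

Lemma comma_compDr X Y Z (g : comma_hom Y Z) (f f' : comma_hom X Y) :
  comma_comp g (f + f') = comma_comp g f + comma_comp g f'.
Proof. by apply: comma_eq; apply: compDr. Qed.

Definition comma : preadditive :=
  @Preadditive comma_obj (fun X Y => comma_hom X Y) comma_id comma_comp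
    comma_compA comma_comp1m comma_compm1 comma_compDl comma_compDr.

End Comma.

Section CommaAbelian.
Variables (A B : abcat) (F : addfun A B).
Hypothesis rF : right_exact F.
Implicit Types X Y Z : comma F.

Let abA := abcatP A.
Let abB := abcatP B.

Lemma right_exact_cokernel (X Y Z : A) (f : hom X Y) (g : hom Y Z) :
  is_cokernel f g -> is_cokernel (fmap F f) (fmap F g).
Proof.
move=> h; have [e1 e2] := (exact_epi_cokernel abA f g).2 h.
exact/(exact_epi_cokernel abB)/rF.
Qed.

Lemma comma_kernelP X Y K (f : hom X Y) (k : hom K X) :
  is_kernel (hfst f) (hfst k) -> is_kernel (hsnd f) (hsnd k) -> is_kernel f k.
Proof.
move=> ka kb; apply: is_kernelP.
- by apply: comma_eq; [case: ka|case: kb].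
- move=> T u v e; apply: comma_eq.
    by apply: (kernel_mono ka); apply: (congr1 (@hfst _ _ F _ _) e).
  by apply: (kernel_mono kb); apply: (congr1 (@hsnd _ _ F _ _) e).
move=> T t ft.
have [a ea] := kernel_lift ka (congr1 (@hfst _ _ F _ _) ft).
have [b eb] := kernel_lift kb (congr1 (@hsnd _ _ F _ _) ft).
have sq : b ∘ cmap T = cmap K ∘ fmap F a.
  apply: (kernel_mono kb); rewrite compA eb comma_sq compA comma_sq -compA.
  by rewrite -fmapM ea.
by exists (mk_comma sq); apply: comma_eq.
Qed.

Lemma comma_cokernelP X Y K (f : hom X Y) (k : hom Y K) :
  is_cokernel (hfst f) (hfst k) -> is_cokernel (hsnd f) (hsnd k) ->
  is_cokernel f k.
Proof.
move=> ka kb; apply: is_cokernelP.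
- by apply: comma_eq; [case: ka|case: kb].
- move=> T u v e; apply: comma_eq.
    by apply: (cokernel_epi ka); apply: (congr1 (@hfst _ _ F _ _) e).
  by apply: (cokernel_epi kb); apply: (congr1 (@hsnd _ _ F _ _) e).
move=> T t ft.
have [a ea] := cokernel_lift ka (congr1 (@hfst _ _ F _ _) ft).
have [b eb] := cokernel_lift kb (congr1 (@hsnd _ _ F _ _) ft).
have sq : b ∘ cmap K = cmap T ∘ fmap F a.
  apply: (cokernel_epi (right_exact_cokernel ka)).
  by rewrite -!compA -comma_sq -fmapM ea compA eb comma_sq.
by exists (mk_comma sq); apply: comma_eq.
Qed.

Lemma comma_kernel X Y (f : hom X Y) : exists K (k : hom K X),
  is_kernel (hfst f) (hfst k) /\ is_kernel (hsnd f) (hsnd k).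
Proof.
have [Ka [a ka]] := ab_kernel abA (hfst f).
have [Kb [b kb]] := ab_kernel abB (hsnd f).
have [phi e] : exists phi, b ∘ phi = cmap X ∘ fmap F a.
  by apply: (kernel_lift kb); rewrite compA comma_sq -compA -fmapM ka.1 fmap0 compm0.
exists (@CommaObj _ _ F Ka Kb phi).
by exists (@mk_comma _ _ F (CommaObj phi) X a b e).
Qed.

Lemma comma_cokernel X Y (f : hom X Y) : exists K (k : hom Y K),
  is_cokernel (hfst f) (hfst k) /\ is_cokernel (hsnd f) (hsnd k).
Proof.
have [Ka [a ka]] := ab_cokernel abA (hfst f).
have [Kb [b kb]] := ab_cokernel abB (hsnd f).
have [phi e] : exists phi, phi ∘ fmap F a = b ∘ cmap Y.
  apply: (cokernel_lift (right_exact_cokernel ka)).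
  by rewrite -compA -comma_sq compA kb.1 comp0m.
exists (@CommaObj _ _ F Ka Kb phi).
by exists (@mk_comma _ _ F Y (CommaObj phi) a b (esym e)).
Qed.

Lemma kernel0_mono (C : preadditive) (X Y K : C) (f : hom X Y) (k : hom K X) :
  is_kernel f k -> k = 0 -> mono f.
Proof.
by move=> hk k0; apply: monoP => T u /(kernel_lift hk) [s <-]; rewrite k0 comp0m.
Qed.

Lemma cokernel0_epi (C : preadditive) (X Y K : C) (f : hom X Y) (k : hom Y K) :
  is_cokernel f k -> k = 0 -> epi f.
Proof.
by move=> hk k0; apply: epiP => T u /(cokernel_lift hk) [s <-]; rewrite k0 compm0.
Qed.

Lemma comma_mono X Y (f : hom X Y) : mono f -> mono (hfst f) /\ mono (hsnd f).
Proof.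
move=> mf; have [K [k [ka kb]]] := comma_kernel f.
have k0 : k = 0 by apply: (mono0 mf); have [] := comma_kernelP ka kb.
by split; [apply: (kernel0_mono ka)|apply: (kernel0_mono kb)]; rewrite k0.
Qed.

Lemma comma_epi X Y (f : hom X Y) : epi f -> epi (hfst f) /\ epi (hsnd f).
Proof.
move=> mf; have [K [k [ka kb]]] := comma_cokernel f.
have k0 : k = 0 by apply: (epi0 mf); have [] := comma_cokernelP ka kb.
by split; [apply: (cokernel0_epi ka)|apply: (cokernel0_epi kb)]; rewrite k0.
Qed.

Lemma comma_biproduct X Y : exists S (i1 : hom X S) (i2 : hom Y S) p1 p2,
  is_biproduct i1 i2 p1 p2.
Proof.
have [_ /(_ (cfst X) (cfst Y)) [Sa [i1 [i2 [p1 [p2 [ea1 ea2 ea3 ea4 ea5]]]]]] _ _ _] := abA.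
have [_ /(_ (csnd X) (csnd Y)) [Sb [j1 [j2 [q1 [q2 [eb1 eb2 eb3 eb4 eb5]]]]]] _ _ _] := abB.
pose phi := j1 ∘ cmap X ∘ fmap F p1 + j2 ∘ cmap Y ∘ fmap F p2.
have s1 : j1 ∘ cmap X = phi ∘ fmap F i1.
  by rewrite compDl -!compA -!fmapM ea1 ea4 fmap0 fmap1 !compm0 addr0 compm1.
have s2 : j2 ∘ cmap Y = phi ∘ fmap F i2.
  by rewrite compDl -!compA -!fmapM ea2 ea3 fmap0 fmap1 !compm0 add0r compm1.
have s3 : q1 ∘ phi = cmap X ∘ fmap F p1.
  by rewrite compDr !compA eb1 eb3 comp1m !comp0m addr0.
have s4 : q2 ∘ phi = cmap Y ∘ fmap F p2.
  by rewrite compDr !compA eb2 eb4 comp1m !comp0m add0r.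
exists (@CommaObj _ _ F Sa Sb phi).
exists (@mk_comma _ _ F X (CommaObj phi) _ _ s1), (@mk_comma _ _ F Y (CommaObj phi) _ _ s2).
exists (@mk_comma _ _ F (CommaObj phi) X _ _ s3), (@mk_comma _ _ F (CommaObj phi) Y _ _ s4).
by split; apply: comma_eq.
Qed.

Lemma comma_abelian : abelian (comma F).
Proof.
split.
- have [[ZA zA] _ _ _ _] := abA; have [[ZB zB] _ _ _ _] := abB.
  by exists (@CommaObj _ _ F ZA ZB 0); apply: comma_eq.
- exact: comma_biproduct.
- split=> X Y f.
    by have [K [k [ka kb]]] := comma_kernel f; exists K, k; apply: comma_kernelP.
  by have [K [k [ka kb]]] := comma_cokernel f; exists K, k; apply: comma_cokernelP.
- move=> X Y f /comma_mono [ma mb]; have [K [k [ka kb]]] := comma_cokernel f.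
  exists K, k; apply: comma_kernelP; first exact: (ab_mono abA).
  exact: (ab_mono abB).
- move=> X Y f /comma_epi [ma mb]; have [K [k [ka kb]]] := comma_kernel f.
  exists K, k; apply: comma_cokernelP; first exact: (ab_epi abA).
  exact: (ab_epi abB).
Qed.

Definition comma_ab : abcat := AbCat comma_abelian.

End CommaAbelian.

Section Complexes.
Implicit Types C D : preadditive.

Record zsequence C := ZSequence {
  zterm :> int -> C;
  zdiff : forall n : int, hom (zterm n) (zterm (n + 1))
}.

Definition zexact C (Q : zsequence C) :=
  forall n : int, exact (zdiff Q n) (zdiff Q (n + 1)).

Definition zprojective C (Q : zsequence C) := forall n : int, projective (Q n).

(* Exactness of the complex of abelian groups Hom(Q, X). *)
Definition hom_exact C (Q : zsequence C) (X : C) :=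
  forall (n : int) (h : hom (Q (n + 1)) X),
    h ∘ zdiff Q n = 0 <-> exists g : hom (Q (n + 1 + 1)) X, g ∘ zdiff Q (n + 1) = h.

Definition zmap C D (F : addfun C D) (Q : zsequence C) : zsequence D :=
  @ZSequence D (fun n => F (Q n)) (fun n => fmap F (zdiff Q n)).

Definition complete_resolution C (Q : zsequence C) :=
  [/\ zprojective Q, zexact Q & forall P : C, projective P -> hom_exact Q P].

(* With Q_n in degree - n - 1 and Q^n in degree n, the map Q_0 -> Q^0 is the
   differential leaving degree -1. *)
Definition gorenstein_projective C (G : C) :=
  exists (Q : zsequence C) (I : C) (m : hom I (Q (-1 + 1))),
    [/\ complete_resolution Q, is_image (zdiff Q (-1)) m & isomorphic G I].

Definition perfect C D (F : addfun C D) :=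
  (forall Q : zsequence C, zprojective Q -> zexact Q -> zexact (zmap F Q)) /\
  (forall (P : zsequence D) (Q : C), complete_resolution P -> projective Q ->
     hom_exact P (F Q)).

End Complexes.

Record gp (C : preadditive) := GP {
  gp_val :> C;
  gpP : gorenstein_projective gp_val
}.

Section Stable.
Variable C : abcat.

Definition factors_projective (X Y : C) : {pred hom X Y} := fun f =>
  `[< exists (P : C) (b : hom P Y) (a : hom X P), projective P /\ b ∘ a = f >].

Lemma projective_biproduct (X Y S : C) (i1 : hom X S) (i2 : hom Y S) p1 p2 :
  is_biproduct i1 i2 p1 p2 -> projective X -> projective Y -> projective S.
Proof.
move=> [_ _ _ _ e] pX pY U V q f eq.
have [g1 e1] := pX _ _ q (f ∘ i1) eq; have [g2 e2] := pY _ _ q (f ∘ i2) eq.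
exists (g1 ∘ p1 + g2 ∘ p2).
by rewrite compDr !compA e1 e2 -!compA -compDr e compm1.
Qed.

Lemma projective_zero (X : C) : is_zero X -> projective X.
Proof. by move=> z U V e f _; exists 0; rewrite compm0 -(compm1 f) z compm0. Qed.

Lemma factors_projective_zmod_closed (X Y : C) :
  zmod_closed (@factors_projective X Y).
Proof.
have [[Z z] bip _ _ _] := abcatP C; split.
  by apply/asboolP; exists Z, 0, 0; rewrite comp0m; split=> //; apply: projective_zero.
move=> f g /asboolP [P [b [a [pP <-]]]] /asboolP [P' [b' [a' [pP' <-]]]].
apply/asboolP; have [S [i1 [i2 [p1 [p2 h]]]]] := bip P P'.
exists S, (b ∘ p1 - b' ∘ p2), (i1 ∘ a + i2 ∘ a').
split; first exact: projective_biproduct h pP pP'.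
have [e1 e2 e3 e4 _] := h.
rewrite compDr !compBl !compA -!(compA b) -!(compA b') e1 e2 e3 e4.
by rewrite !comp0m !compm0 !comp1m subr0 sub0r.
Qed.

HB.instance Definition _ X Y :=
  GRing.isZmodClosed.Build _ (@factors_projective X Y)
    (@factors_projective_zmod_closed X Y).

Definition stable_hom (X Y : gp C) : zmodType :=
  Quotient.quot (@factors_projective X Y).

Definition stable_pi (X Y : gp C) (f : hom (X : C) (Y : C)) : stable_hom X Y :=
  \pi_(stable_hom X Y) f.

Lemma stable_piD (X Y : gp C) (f g : hom (X : C) (Y : C)) :
  stable_pi (f + g) = stable_pi f + stable_pi g.
Proof. exact: (raddfD (\pi_(Quotient.quot (@factors_projective X Y)))). Qed.

Lemma stable_piB (X Y : gp C) (f g : hom (X : C) (Y : C)) :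
  stable_pi (f - g) = stable_pi f - stable_pi g.
Proof. exact: (raddfB (\pi_(Quotient.quot (@factors_projective X Y)))). Qed.

Lemma stable_pi_eq (X Y : gp C) (f g : hom (X : C) (Y : C)) :
  stable_pi f = stable_pi g <->
  exists (P : C) (b : hom P Y) (a : hom (X : C) P), projective P /\ b ∘ a = f - g.
Proof.
have e := @Quotient.idealrBE _ (@factors_projective X Y) f g.
split.
  by move=> /eqP h; apply/asboolP; move: h; rewrite /stable_pi -e.
by move=> /asboolP h; apply/eqP; rewrite /stable_pi -e.
Qed.

Definition stable_repr (X Y : gp C) (f : stable_hom X Y) : hom (X : C) (Y : C) :=
  repr (f : Quotient.quot (@factors_projective X Y)).

Lemma stable_reprK (X Y : gp C) (f : stable_hom X Y) :
  stable_pi (stable_repr f) = f.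
Proof. exact: reprK. Qed.

Definition stable_comp (X Y Z : gp C) (g : stable_hom Y Z) (f : stable_hom X Y) :
  stable_hom X Z := stable_pi (stable_repr g ∘ stable_repr f).

Lemma stable_compE (X Y Z : gp C) (g : hom (Y : C) (Z : C)) (f : hom (X : C) (Y : C)) :
  stable_comp (stable_pi g) (stable_pi f) = stable_pi (g ∘ f).
Proof.
have /stable_pi_eq [P [b [a [pP e]]]] := stable_reprK (stable_pi g).
have /stable_pi_eq [P' [b' [a' [pP' e']]]] := stable_reprK (stable_pi f).
rewrite /stable_comp; set g' := stable_repr _ in e *; set f' := stable_repr _ in e' *.
transitivity (stable_pi (g ∘ f')); apply/stable_pi_eq.
  by exists P, b, (a ∘ f'); rewrite compA e compBl.
by exists P', (g ∘ b'), a'; rewrite -compA e' compBr.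
Qed.

Lemma stable_ind (X Y : gp C) (K : stable_hom X Y -> Prop) :
  (forall f, K (stable_pi f)) -> forall f, K f.
Proof. by move=> h f; rewrite -(stable_reprK f). Qed.

Definition stable_id (X : gp C) : stable_hom X X := stable_pi (idm (X : C)).

Lemma stable_compA (X Y Z W : gp C) (h : stable_hom Z W) (g : stable_hom Y Z)
    (f : stable_hom X Y) :
  stable_comp h (stable_comp g f) = stable_comp (stable_comp h g) f.
Proof.
elim/stable_ind: h => h; elim/stable_ind: g => g; elim/stable_ind: f => f.
by rewrite !stable_compE compA.
Qed.

Lemma stable_comp1m (X Y : gp C) (f : stable_hom X Y) :
  stable_comp (stable_id Y) f = f.
Proof. by elim/stable_ind: f => f; rewrite stable_compE comp1m. Qed.

Lemma stable_compm1 (X Y : gp C) (f : stable_hom X Y) :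
  stable_comp f (stable_id X) = f.
Proof. by elim/stable_ind: f => f; rewrite stable_compE compm1. Qed.

Lemma stable_compDl (X Y Z : gp C) (g g' : stable_hom Y Z) (f : stable_hom X Y) :
  stable_comp (g + g') f = stable_comp g f + stable_comp g' f.
Proof.
elim/stable_ind: g => g; elim/stable_ind: g' => g'; elim/stable_ind: f => f.
by rewrite -stable_piD !stable_compE compDl stable_piD.
Qed.

Lemma stable_compDr (X Y Z : gp C) (g : stable_hom Y Z) (f f' : stable_hom X Y) :
  stable_comp g (f + f') = stable_comp g f + stable_comp g f'.
Proof.
elim/stable_ind: g => g; elim/stable_ind: f => f; elim/stable_ind: f' => f'.
by rewrite -stable_piD !stable_compE compDr stable_piD.
Qed.

Definition stable_cat : preadditive :=
  @Preadditive (gp C) stable_hom stable_id stable_comp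
    stable_compA stable_comp1m stable_compm1 stable_compDl stable_compDr.

Definition zshift (Q : zsequence C) : zsequence C :=
  @ZSequence C (fun n => Q (n + 1)) (fun n => zdiff Q (n + 1)).

Lemma zshift_complete (Q : zsequence C) :
  complete_resolution Q -> complete_resolution (zshift Q).
Proof.
move=> [pQ eQ hQ]; split=> [n|n|P pP n h]; first exact: pQ.
  exact: eQ.
exact: (hQ P pP (n + 1) h).
Qed.

(* A conflation 0 -> X -> I -> S -> 0 of GP(C) with I projective. *)
Record hull (X : gp C) := Hull {
  hull_mid : C;
  hull_cok : gp C;
  hull_in : hom (X : C) hull_mid;
  hull_out : hom hull_mid (hull_cok : C);
  hull_proj : projective hull_mid;
  hull_exact : short_exact hull_in hull_out
}.

Arguments hull_in {X} h.
Arguments hull_out {X} h.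
Arguments hull_proj {X} h.
Arguments hull_exact {X} h.

Lemma hull_exists (X : gp C) : exists h : hull X, True.
Proof.
have abC := abcatP C.
have [Q [I [m [cQ im [s hs]]]]] := gpP X.
have [S [m2 im2]] := ab_image abC (zdiff Q (-1 + 1)).
have [p [ep e]] := image_factor abC im2.
have gS : gorenstein_projective S.
  exists (zshift Q), S, m2; split=> //; first exact: zshift_complete.
  by exists (idm S), (idm S); rewrite comp1m.
have [pQ eQ _] := cQ.
have km : is_kernel p m.
  apply/(mono_kernel_comp p m (image_mono im2)); rewrite e.
  exact: exact_image_kernel (eQ (-1)) im.
have kms := kernel_iso hs km.
exists (@Hull X (Q (-1 + 1)) (GP gS) (m ∘ s) p (pQ _) (conj kms (ab_epi abC ep kms))).
by [].
Qed.

Lemma conflation_extend_aux (Q : zsequence C) (n : int) (X I S P : C)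
    (m : hom S (Q (n + 1 + 1 + 1))) (i : hom X I) (p : hom I S) (h : hom X P) :
  complete_resolution Q -> is_image (zdiff Q (n + 1 + 1)) m ->
  short_exact i p -> projective P -> exists g : hom I P, g ∘ i = h.
Proof.
have abC := abcatP C => -[pQ eQ hQ] im [ki cp] pP.
have [e [ee me]] := image_factor abC im.
have [N [n1 imn]] := ab_image abC (zdiff Q (n + 1)).
have kn : is_kernel e n1.
  apply/(mono_kernel_comp e n1 (image_mono im)); rewrite me.
  exact: exact_image_kernel (eQ (n + 1)) imn.
have [e1 [ee1 me1]] := image_factor abC imn.
have [t pt] := pQ (n + 1 + 1) _ _ p e (cokernel_epi cp).
have [r ir] : exists r, i ∘ r = t ∘ n1.
  by apply: (kernel_lift ki); rewrite compA pt kn.1.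
have [q qd] : exists q, q ∘ zdiff Q (n + 1) = h ∘ r ∘ e1.
  apply/(hQ P pP n); rewrite -!compA (_ : r ∘ _ = 0) ?compm0 //.
  apply: (mono0 (kernel_mono ki)); rewrite compA ir -compA (compA n1) me1.
  by rewrite (exact0 (eQ n)) compm0.
have qn : q ∘ n1 = h ∘ r by apply: ee1; rewrite -compA me1.
have [_ /(_ X (Q (n + 1 + 1))) [B [i1 [i2 [p1 [p2 [e11 e22 e12 e21 _]]]]]] _ _ _] := abC.
pose s := i ∘ p1 + t ∘ p2.
have si1 : s ∘ i1 = i by rewrite compDl -!compA e11 e21 compm0 compm1 addr0.
have si2 : s ∘ i2 = t by rewrite compDl -!compA e12 e22 compm0 compm1 add0r.
have es : epi s.
  apply: epiP => T u us.
  have ui : u ∘ i = 0 by rewrite -si1 compA us comp0m.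
  have [u' eu'] := cokernel_lift cp ui.
  suff u0 : u' = 0 by rewrite -eu' u0 comp0m.
  by apply: (epi0 ee); rewrite -pt compA eu' -si2 compA us comp0m.
have [K [k kk]] := ab_kernel abC s; have cs := ab_epi abC es kk.
have sk : i ∘ (p1 ∘ k) = - (t ∘ (p2 ∘ k)).
  by apply/eqP; rewrite -addr_eq0 !compA -compDl kk.1.
have [k' ek'] : exists k', n1 ∘ k' = p2 ∘ k.
  apply: (kernel_lift kn); rewrite -pt -compA -[LHS]opprK -compNr -sk.
  by rewrite compA ki.1 comp0m oppr0.
have ep1 : p1 ∘ k = - (r ∘ k').
  by apply: (kernel_mono ki); rewrite sk -ek' compNr !compA ir.
have [g eg] : exists g, g ∘ s = h ∘ p1 + q ∘ p2.
  apply: (cokernel_lift cs).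
  by rewrite compDl -!compA ep1 -ek' compNr !compA qn addNr.
exists g; rewrite -si1 compA eg compDl -!compA e11 e21.
by rewrite compm0 compm1 addr0.
Qed.

(* Projectives are injective relative to conflations ending in GP(C). *)
Lemma conflation_extend (X I S P : C) (i : hom X I) (p : hom I S) (h : hom X P) :
  short_exact i p -> gorenstein_projective S -> projective P ->
  exists g : hom I P, g ∘ i = h.
Proof.
move=> ip [Q [S' [m [cQ [K [c [hc hm]]] [s hs]]]]] pP.
apply: (@conflation_extend_aux Q (- 3) X I S P (m ∘ s) i p h) => //.
by exists K, c; split=> //; apply: kernel_iso.
Qed.

Definition hull_of (X : gp C) : hull X := projT1 (cid (hull_exists X)).

Lemma conflation_null (X Y X' Y' : gp C) (I J : C)
    (i : hom (X : C) I) (p : hom I (X' : C)) (j : hom (Y : C) J) (q : hom J (Y' : C))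
    (f : hom (X : C) (Y : C)) (u : hom I J) (g : hom (X' : C) (Y' : C)) :
  short_exact i p -> short_exact j q -> projective J ->
  u ∘ i = j ∘ f -> g ∘ p = q ∘ u -> stable_pi f = stable_pi 0 ->
  stable_pi g = stable_pi 0.
Proof.
move=> ip jq pJ ui gp' /stable_pi_eq [P [b [a [pP e]]]].
have [a' ea] := conflation_extend a ip (gpP X') pP.
rewrite subr0 in e.
have [c ec] : exists c, c ∘ p = u - j ∘ b ∘ a'.
  by apply: (cokernel_lift ip.2); rewrite compBl ui -!compA ea e subrr.
apply/stable_pi_eq; exists J, q, c; split=> //; rewrite subr0.
apply: (cokernel_epi ip.2); rewrite -compA ec compBr gp' !compA jq.1.1.
by rewrite !comp0m subr0.
Qed.

Definition shift_pair (X Y : gp C) (f : hom (X : C) (Y : C))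
    (u : hom (hull_mid (hull_of X)) (hull_mid (hull_of Y)))
    (g : hom (hull_cok (hull_of X) : C) (hull_cok (hull_of Y) : C)) :=
  u ∘ hull_in (hull_of X) = hull_in (hull_of Y) ∘ f /\
  g ∘ hull_out (hull_of X) = hull_out (hull_of Y) ∘ u.

Lemma shift_pair_exists (X Y : gp C) (f : hom (X : C) (Y : C)) :
  exists g u, shift_pair f u g.
Proof.
have ex := hull_exact (hull_of X); have ey := hull_exact (hull_of Y).
have [u eu] := conflation_extend (hull_in (hull_of Y) ∘ f) ex
  (gpP (hull_cok (hull_of X))) (hull_proj (hull_of Y)).
have [g eg] : exists g, g ∘ hull_out (hull_of X) = hull_out (hull_of Y) ∘ u.
  by apply: (cokernel_lift ex.2); rewrite -compA eu compA ey.1.1 comp0m.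
by exists g, u.
Qed.

Definition shift_obj (X : gp C) : gp C := hull_cok (hull_of X).

Definition shift_hom (X Y : gp C) (f : stable_hom X Y) :
    stable_hom (shift_obj X) (shift_obj Y) :=
  stable_pi (projT1 (cid (shift_pair_exists (stable_repr f)))).

Lemma shift_homE (X Y : gp C) (f : hom (X : C) (Y : C)) u g :
  shift_pair f u g -> shift_hom (stable_pi f) = stable_pi g.
Proof.
move=> [e1 e2]; rewrite /shift_hom; case: cid => g' /= [u' [e1' e2']].
have e := stable_reprK (stable_pi f).
suff : stable_pi (g' - g) = stable_pi 0.
  move=> h; apply/eqP; rewrite -subr_eq0 -stable_piB h -(subrr g) stable_piB.
  by rewrite subrr.
set f' := stable_repr _ in e e1'.
apply: (conflation_null (hull_exact (hull_of X)) (hull_exact (hull_of Y))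
  (hull_proj (hull_of Y)) (f := f' - f) (u := u' - u)).
- by rewrite compBl compBr e1 e1'.
- by rewrite compBl compBr e2 e2'.
- by rewrite stable_piB e -stable_piB subrr.
Qed.

Lemma shift_hom1 (X : gp C) : shift_hom (stable_id X) = stable_id (shift_obj X).
Proof. by apply: (@shift_homE _ _ _ (idm _)); split; rewrite comp1m compm1. Qed.

Lemma shift_homM (X Y Z : gp C) (g : stable_hom Y Z) (f : stable_hom X Y) :
  shift_hom (stable_comp g f) = stable_comp (shift_hom g) (shift_hom f).
Proof.
elim/stable_ind: g => g; elim/stable_ind: f => f.
have [g' [u pg]] := shift_pair_exists g; have [f' [v pf]] := shift_pair_exists f.
rewrite (shift_homE pg) (shift_homE pf) !stable_compE.
have [[eg eg'] [ef ef']] := (pg, pf).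
apply: (@shift_homE _ _ _ (u ∘ v)); split.
  by rewrite -compA ef !compA eg.
by rewrite -compA ef' !compA eg'.
Qed.

Lemma shift_homD (X Y : gp C) (f g : stable_hom X Y) :
  shift_hom (f + g) = shift_hom f + shift_hom g.
Proof.
elim/stable_ind: g => g; elim/stable_ind: f => f.
have [g' [u pg]] := shift_pair_exists g; have [f' [v pf]] := shift_pair_exists f.
rewrite (shift_homE pg) (shift_homE pf) -!stable_piD.
have [[eg eg'] [ef ef']] := (pg, pf).
apply: (@shift_homE _ _ _ (v + u)); split.
  by rewrite compDl compDr ef eg.
by rewrite compDl compDr ef' eg'.
Qed.

Definition stable_shift : addfun stable_cat stable_cat :=
  @AddFun stable_cat stable_cat shift_obj shift_hom shift_hom1 shift_homM shift_homD.

(* The triangle of a conflation 0 -> X -> Y -> Z -> 0 of GP(C): its third map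
   is induced by an extension Y -> I of X -> I, where 0 -> X -> I -> X[1] -> 0
   is the chosen conflation with I projective. *)
Definition standard_triangle (X Y Z : stable_cat)
    (u : hom X Y) (v : hom Y Z) (w : hom Z (stable_shift X)) :=
  exists (f : hom (gp_val X) (gp_val Y)) (g : hom (gp_val Y) (gp_val Z))
         (a : hom (gp_val Y) (hull_mid (hull_of X)))
         (c : hom (gp_val Z) (gp_val (shift_obj X))),
    [/\ short_exact f g,
        a ∘ f = hull_in (hull_of X),
        c ∘ g = hull_out (hull_of X) ∘ a
      & [/\ u = stable_pi f, v = stable_pi g & w = stable_pi c]].

Definition stable_triangle (X Y Z : stable_cat)
    (u : hom X Y) (v : hom Y Z) (w : hom Z (stable_shift X)) :=
  exists (X' Y' Z' : stable_cat) (u' : hom X' Y') (v' : hom Y' Z')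
         (w' : hom Z' (stable_shift X'))
         (x : hom X X') (y : hom Y Y') (z : hom Z Z'),
    [/\ standard_triangle u' v' w',
        [/\ is_iso x, is_iso y & is_iso z],
        y ∘ u = u' ∘ x,
        z ∘ v = v' ∘ y
      & fmap stable_shift x ∘ w = w' ∘ z].

End Stable.

(* The data of a triangulated category: suspension functor and distinguished
   triangles. The axioms (TR1)-(TR4) do not enter the definitions of triangle
   functors and left recollements, so they are not part of the record. *)
Record tricat := Tricat {
  tri_cat :> preadditive;
  shift : addfun tri_cat tri_cat;
  distinguished : forall X Y Z : tri_cat,
    hom X Y -> hom Y Z -> hom Z (shift X) -> Prop
}.

Arguments shift {t}.
Arguments distinguished {t X Y Z}.

Definition stable_gp (C : abcat) : tricat :=
  @Tricat (stable_cat C) (stable_shift C) (@stable_triangle C).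

Record trifun (S T : tricat) := Trifun {
  tri_fun :> addfun S T;
  tri_shift : forall X : S, hom (tri_fun (shift X)) (shift (tri_fun X));
  tri_shift_iso : forall X, is_iso (tri_shift X);
  tri_shift_natural : forall (X Y : S) (f : hom X Y),
    tri_shift Y ∘ fmap tri_fun (fmap shift f) =
    fmap shift (fmap tri_fun f) ∘ tri_shift X;
  tri_distinguished : forall (X Y Z : S) (u : hom X Y) (v : hom Y Z)
      (w : hom Z (shift X)),
    distinguished u v w ->
    distinguished (fmap tri_fun u) (fmap tri_fun v)
                  (tri_shift X ∘ fmap tri_fun w)
}.

(* L is left adjoint to R. *)
Record adjunction (C D : preadditive) (L : addfun C D) (R : addfun D C) := Adjunction {
  unit_of : forall X : C, hom X (R (L X));
  counit_of : forall Y : D, hom (L (R Y)) Y;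
  unit_natural : forall (X X' : C) (f : hom X X'),
    unit_of X' ∘ f = fmap R (fmap L f) ∘ unit_of X;
  counit_natural : forall (Y Y' : D) (g : hom Y Y'),
    counit_of Y' ∘ fmap L (fmap R g) = g ∘ counit_of Y;
  counit_unit : forall X : C, counit_of (L X) ∘ fmap L (unit_of X) = idm (L X);
  unit_counit : forall Y : D, fmap R (counit_of Y) ∘ unit_of (R Y) = idm (R Y)
}.

Definition fully_faithful (C D : preadditive) (F : addfun C D) :=
  forall X Y : C, bijective (fun f : hom X Y => fmap F f).

(* Left recollement of T relative to T1 and T2, with functors
   i^* = iu, i_* = il, j_! = jl, j^* = ju. *)
Definition left_recollement (T1 T T2 : tricat) (iu : trifun T T1)
    (il : trifun T1 T) (jl : trifun T2 T) (ju : trifun T T2) : Prop :=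
  exists (adi : adjunction iu il) (adj : adjunction jl ju),
    [/\ fully_faithful il /\ fully_faithful jl,
        forall X : T1, is_zero (ju (il X))
      & forall X : T, exists w : hom (il (iu X)) (shift (jl (ju X))),
          distinguished (counit_of adj X) (unit_of adi X) w].

(* Main.v *)
(* The functors are i^* (A, B)_phi = Coker phi, i_* B = (0, B),
   j_! A = (A, FA)_id and j^* (A, B)_phi = A. On the abelian categories they
   form adjoint pairs Coker -| (0, -) -| snd and (-, F-) -| fst -| (-, 0), so
   all four preserve cokernels and projectives; by (P1) and (P2) they also
   preserve complete resolutions. A functor with these three properties
   preserves Gorenstein projectives and short exact sequences with Gorenstein
   projective cokernel, hence it induces a triangle functor on stable
   categories, and adjunctions descend. Finally phi is a monomorphism when
   (A, B)_phi is Gorenstein projective, and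
   0 -> (A, FA) -> (A, B) -> (0, Coker phi) -> 0 gives the triangle. No
   enough-projectives assumption is needed, since every Gorenstein projective
   has a syzygy taken from its own complete resolution. *)

From mathcomp Require Import all_boot all_algebra.
From mathcomp Require Import boolp.
Require Import Defs.

Set Implicit Arguments.
Unset Strict Implicit.
Unset Printing Implicit Defensive.

Import GRing.Theory.
Local Open Scope ring_scope.

(** * Exactness in an abelian category through generalized elements *)

Section AbelianCategory.
Variable C : abcat.
Implicit Types X Y Z T : C.

Let abC := abcatP C.

(** Epimorphisms are stable under pullback. The pullback is the kernel of [e ∘ p1 - t ∘ p2] on X (+)
    T, with projections [t'] and [q]. In diagram chases this replaces the choice of a preimage. *)
Lemma epi_lift X Y T (e : hom X Y) (t : hom T Y) : epi e ->
  exists T' (q : hom T' T) (t' : hom T' X), epi q /\ e ∘ t' = t ∘ q.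
Proof.
move=> ee.
have [_ /(_ X T) [S [i1 [i2 [p1 [p2 [e11 e22 e12 e21 _]]]]]] _ _ _] := abC.
pose s := e ∘ p1 - t ∘ p2.
have si1 : s ∘ i1 = e by rewrite compBl -!compA e11 e21 compm0 compm1 subr0.
have es : epi s.
  by apply: epiP => W u us; apply: (epi0 ee); rewrite -si1 compA us comp0m.
have [K [k hk]] := ab_kernel abC s; have cs := ab_epi abC es hk.
exists K, (p2 ∘ k), (p1 ∘ k); split; last first.
  by apply/eqP; rewrite -subr_eq0 !compA -compBl; apply/eqP; case: hk.
apply: epiP => W u; rewrite compA => uk.
have [v ev] := cokernel_lift cs uk.
have v0 : v = 0.
  by apply: (epi0 ee); rewrite -si1 compA ev -compA e21 compm0.
by rewrite -(compm1 u) -e22 compA -ev v0 !comp0m.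
Qed.

(** The cycle [t] factors through the image of [f], and this factorization lifts to [X] over an
    epimorphic cover of [T]. With the converse [exactP], exactness can be checked by chasing
    elements. *)
Lemma exact_lift X Y Z (f : hom X Y) (g : hom Y Z) T (t : hom T Y) :
  exact f g -> g ∘ t = 0 ->
  exists T' (q : hom T' T) (t' : hom T' X), epi q /\ f ∘ t' = t ∘ q.
Proof.
move=> [I [m [im km]]] gt; have [e [ee me]] := image_factor abC im.
have [s ms] := kernel_lift km gt; have [T' [q [t' [eq et]]]] := epi_lift s ee.
by exists T', q, t'; split=> //; rewrite -me -compA et compA ms.
Qed.

Lemma exactP X Y Z (f : hom X Y) (g : hom Y Z) :
  g ∘ f = 0 ->
  (forall T (t : hom T Y), g ∘ t = 0 ->
     exists T' (q : hom T' T) (t' : hom T' X), epi q /\ f ∘ t' = t ∘ q) ->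
  exact f g.
Proof.
move=> gf h; have [I [m im]] := ab_image abC f; exists I, m; split=> //.
have [e [ee me]] := image_factor abC im; have [K [c [hc kc]]] := im.
apply: is_kernelP (image_mono im) _.
  by apply: (epi0 ee); rewrite -compA me.
move=> T t /h [T' [q [t' [eq et]]]]; apply: (kernel_lift kc).
by apply: (epi0 eq); rewrite -compA -et compA hc.1 comp0m.
Qed.

(** As [m] is mono, [e] and [g] have the same kernel, and an epimorphism is the cokernel of its
    kernel. So in an exact complex the image of a differential is the cokernel of the preceding one,
    a description that functors preserving cokernels respect. *)
Lemma exact_cokernel X Y Z I (f : hom X Y) (g : hom Y Z) (m : hom I Z)
    (e : hom Y I) :
  exact f g -> mono m -> epi e -> m ∘ e = g -> is_cokernel f e.
Proof.
move=> [J [n [jn kn]]] mm ee me; apply/(exact_epi_cokernel abC).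
split=> //; exists J, n; split=> //.
by apply/(mono_kernel_comp e n mm); rewrite me.
Qed.

(** The image of [g] is another cokernel of [f] by [exact_cokernel], so [m] is the image inclusion
    up to an isomorphism. *)
Lemma exact_cokernel_mono X Y Z I (f : hom X Y) (g : hom Y Z) (m : hom I Z)
    (e : hom Y I) :
  exact f g -> is_cokernel f e -> m ∘ e = g -> mono m.
Proof.
move=> ex ce me; have [J [n jn]] := ab_image abC g.
have [e' [ee' ne]] := image_factor abC jn.
have ce' := exact_cokernel ex (image_mono jn) ee' ne.
have [s [hs es]] := cokernel_unique ce ce'.
suff -> : m = n ∘ s by apply: mono_comp (image_mono jn) (iso_mono hs).
by apply: (cokernel_epi ce); rewrite -compA es me ne.
Qed.

Lemma short_exactP X Y Z (f : hom X Y) (g : hom Y Z) :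
  mono f -> is_cokernel f g -> short_exact f g.
Proof. by move=> mf cg; split=> //; apply: ab_mono. Qed.

End AbelianCategory.

Lemma fmap_iso (C D : preadditive) (F : addfun C D) (X Y : C) (f : hom X Y) :
  is_iso f -> is_iso (fmap F f).
Proof.
by move=> [g [e1 e2]]; exists (fmap F g); rewrite -!fmapM e1 e2 !fmap1.
Qed.

(** * Exactness of Hom complexes as the target varies *)

Section HomExact.
Variable C : preadditive.
Implicit Types Q : zsequence C.

Lemma hom_exact_biproduct Q (X Y S : C) (i1 : hom X S) (i2 : hom Y S) p1 p2 :
  is_biproduct i1 i2 p1 p2 -> zexact Q -> hom_exact Q X -> hom_exact Q Y ->
  hom_exact Q S.
Proof.
move=> [_ _ _ _ e] eQ hX hY n h; split=> [hd|[g <-]]; last first.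
  by rewrite -compA (exact0 (eQ n)) compm0.
have /hX [a ea] : p1 ∘ h ∘ zdiff Q n = 0 by rewrite -compA hd compm0.
have /hY [b eb] : p2 ∘ h ∘ zdiff Q n = 0 by rewrite -compA hd compm0.
by exists (i1 ∘ a + i2 ∘ b); rewrite compDl -!compA ea eb !compA -compDl e comp1m.
Qed.

(* Hom(Q, -) turns the short exact sequence into one of complexes, as Q
   consists of projectives. *)
Lemma hom_exact_quotient Q (X Y Z : C) (i : hom X Y) (p : hom Y Z) :
  short_exact i p -> zprojective Q -> zexact Q -> hom_exact Q X ->
  hom_exact Q Y -> hom_exact Q Z.
Proof.
(* The index is shifted by one because the obstruction [k] to lifting the cocycle [h] lives one
   degree below [h], where exactness of Hom(Q, X) is used. *)
move=> [ki cp] pQ eQ hX hY n; rewrite -(subrK 1 n); move: (n - 1) => {}n h.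
split=> [hd|[g <-]]; last by rewrite -compA (exact0 (eQ _)) compm0.
have [h' ph] := pQ _ _ _ p h (cokernel_epi cp).
have [k ik] : exists k, i ∘ k = h' ∘ zdiff Q (n + 1).
  by apply: (kernel_lift ki); rewrite compA ph.
have /hX [l el] : k ∘ zdiff Q n = 0.
  apply: (mono0 (kernel_mono ki)).
  by rewrite compA ik -compA (exact0 (eQ n)) compm0.
have /hY [g eg] : (h' - i ∘ l) ∘ zdiff Q (n + 1) = 0.
  by rewrite compBl -compA el ik subrr.
by exists (p ∘ g); rewrite -compA eg compBr compA ki.1 comp0m subr0.
Qed.

End HomExact.

(** * Adjunctions: transposition, projectives, Hom complexes, full faithfulness *)

Section Adjunction.
Variables (C D : preadditive) (L : addfun C D) (R : addfun D C).
Variable adj : adjunction L R.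
Implicit Types (X : C) (Y : D).

Lemma adj_unitK X Y (f : hom (L X) Y) :
  counit_of adj Y ∘ fmap L (fmap R f ∘ unit_of adj X) = f.
Proof. by rewrite fmapM compA counit_natural -compA counit_unit compm1. Qed.

Lemma adj_counitK X Y (g : hom X (R Y)) :
  fmap R (counit_of adj Y ∘ fmap L g) ∘ unit_of adj X = g.
Proof. by rewrite fmapM -compA -unit_natural compA unit_counit comp1m. Qed.

Lemma adj_transpose_comp X X' Y (g : hom (L X) Y) (f : hom X' X) :
  fmap R (g ∘ fmap L f) ∘ unit_of adj X' = fmap R g ∘ unit_of adj X ∘ f.
Proof. by rewrite fmapM -!compA unit_natural. Qed.

Lemma adj_transpose0 X Y (g : hom (L X) Y) :
  fmap R g ∘ unit_of adj X = 0 -> g = 0.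
Proof. by move=> e; rewrite -(adj_unitK g) e fmap0 compm0. Qed.

Lemma left_adjoint_cokernel X X' K (f : hom X X') (c : hom X' K) :
  is_cokernel f c -> is_cokernel (fmap L f) (fmap L c).
Proof.
move=> cc; apply: is_cokernelP.
- by rewrite -fmapM cc.1 fmap0.
- apply: epiP => T u uc; apply: adj_transpose0; apply: (epi0 (cokernel_epi cc)).
  by rewrite -adj_transpose_comp uc fmap0 comp0m.
move=> T t tf; have [s es] : exists s, s ∘ c = fmap R t ∘ unit_of adj X'.
  apply: (cokernel_lift cc).
  by rewrite -adj_transpose_comp tf fmap0 comp0m.
by exists (counit_of adj T ∘ fmap L s); rewrite -compA -fmapM es adj_unitK.
Qed.

(** A lifting problem for [L X] against [e] transposes to one for [X] against [fmap R e]. *)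
Lemma left_adjoint_projective X :
  (forall Y Y' (e : hom Y Y'), epi e -> epi (fmap R e)) ->
  projective X -> projective (L X).
Proof.
move=> hR pX Y Y' e f /hR ee.
have [g eg] := pX _ _ _ (fmap R f ∘ unit_of adj X) ee.
exists (counit_of adj Y ∘ fmap L g).
by rewrite compA -counit_natural -compA -fmapM eg adj_unitK.
Qed.

(** Transposition is bijective and natural, so it identifies the complexes Hom(L Q, Y) and Hom(Q, R
    Y). *)
Lemma adj_hom_exact (Q : zsequence C) Y :
  hom_exact (zmap L Q) Y <-> hom_exact Q (R Y).
Proof.
split=> hQ n h.
- have := hQ n (counit_of adj Y ∘ fmap L h) => /= [[h1 h2]]; split=> [hd|[g eg]].
    have [|g eg] := h1; first by rewrite -compA -fmapM hd fmap0 compm0.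
    exists (fmap R g ∘ unit_of adj _).
    by rewrite -adj_transpose_comp eg adj_counitK.
  have e : counit_of adj Y ∘ fmap L h ∘ fmap L (zdiff Q n) = 0.
    by apply: h2; exists (counit_of adj Y ∘ fmap L g); rewrite /= -compA -fmapM eg.
  by rewrite -(adj_counitK (h ∘ _)) (fmapM L) compA e fmap0 comp0m.
- have [h1 h2] := hQ n (fmap R h ∘ unit_of adj _); split=> [hd|[g eg]] /=.
    have [|g eg] := h1; first by rewrite -adj_transpose_comp hd fmap0 comp0m.
    exists (counit_of adj Y ∘ fmap L g).
    by rewrite -compA -fmapM eg adj_unitK.
  apply: adj_transpose0; rewrite adj_transpose_comp; apply: h2.
  by exists (fmap R g ∘ unit_of adj _); rewrite -adj_transpose_comp eg.
Qed.

Lemma right_adjoint_fully_faithful :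
  (forall Y, is_iso (counit_of adj Y)) -> fully_faithful R.
Proof.
move=> iso Y Y'; have [e [ee1 ee2]] := iso Y.
exists (fun g => counit_of adj Y' ∘ fmap L g ∘ e) => [f|g].
  by rewrite counit_natural -compA ee2 compm1.
rewrite fmapM.
(* By a triangle identity the unit at [R Y] is inverse to R of the counit, so it is R of the inverse
   [e]. *)
have <- : unit_of adj (R Y) = fmap R e.
  rewrite -(comp1m (unit_of _ _)) -fmap1 -ee1 fmapM -compA unit_counit.
  by rewrite compm1.
by rewrite adj_counitK.
Qed.

Lemma left_adjoint_fully_faithful :
  (forall X, is_iso (unit_of adj X)) -> fully_faithful L.
Proof.
move=> iso X X'; have [e [ee1 ee2]] := iso X'.
exists (fun g => e ∘ (fmap R g ∘ unit_of adj X)) => [f|g].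
  by rewrite -unit_natural compA ee1 comp1m.
rewrite fmapM.
have <- : counit_of adj (L X') = fmap L e.
  rewrite -(compm1 (counit_of _ _)) -fmap1 -ee2 fmapM compA counit_unit.
  by rewrite comp1m.
by rewrite adj_unitK.
Qed.

End Adjunction.

(** * Maps between conflations and their uniqueness in the stable category *)

Section Conflations.
Variable C : abcat.

(** The projective [J] is injective relative to conflations ending in GP(C), so [j ∘ f] extends to
    [I]; passing to cokernels gives [g]. *)
Lemma conflation_map (X X' Y : gp C) (Y' I J : C)
    (i : hom (X : C) I) (p : hom I (X' : C)) (j : hom (Y : C) J) (q : hom J Y')
    (f : hom (X : C) (Y : C)) :
  short_exact i p -> short_exact j q -> projective J ->
  exists g u, u ∘ i = j ∘ f /\ g ∘ p = q ∘ u.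
Proof.
move=> ip jq pJ; have [u eu] := conflation_extend (j ∘ f) ip (gpP X') pJ.
have [g eg] : exists g, g ∘ p = q ∘ u.
  by apply: (cokernel_lift ip.2); rewrite -compA eu compA jq.1.1 comp0m.
by exists g, u.
Qed.

(** The differences form a map of conflations over a stably zero morphism, to which
    [conflation_null] applies. *)
Lemma conflation_map_unique (X Y X' Y' : gp C) (I J : C)
    (i : hom (X : C) I) (p : hom I (X' : C)) (j : hom (Y : C) J) (q : hom J (Y' : C))
    (f f' : hom (X : C) (Y : C)) (u u' : hom I J) (g g' : hom (X' : C) (Y' : C)) :
  short_exact i p -> short_exact j q -> projective J ->
  u ∘ i = j ∘ f -> g ∘ p = q ∘ u -> u' ∘ i = j ∘ f' -> g' ∘ p = q ∘ u' ->
  stable_pi f = stable_pi f' -> stable_pi g = stable_pi g'.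
Proof.
move=> ip jq pJ ui gp ui' gp' e; apply/eqP; rewrite -subr_eq0 -stable_piB.
rewrite (_ : stable_pi _ = stable_pi 0); last first.
  apply: (conflation_null ip jq pJ (f := f - f') (u := u - u')).
  - by rewrite compBl compBr ui ui'.
  - by rewrite compBl compBr gp gp'.
  by rewrite stable_piB e -(stable_piB f' f') subrr.
by rewrite -(subrr g) stable_piB subrr.
Qed.

End Conflations.

(** * Functors preserving complete resolutions and the stable functors they induce *)

Section GorensteinFunctor.
Variables (C D : abcat) (Phi : addfun C D).

Let abC := abcatP C.
Let abD := abcatP D.

Definition preserves_cokernels := forall (X Y K : C) (f : hom X Y) (c : hom Y K),
  is_cokernel f c -> is_cokernel (fmap Phi f) (fmap Phi c).

Record gorenstein_functor : Prop := GorensteinFunctor {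
  gorenstein_cokernel : preserves_cokernels;
  gorenstein_complete : forall Q : zsequence C,
    complete_resolution Q -> complete_resolution (zmap Phi Q);
  gorenstein_proj : forall P : C, projective P -> projective (Phi P)
}.

(** The image of a differential is the cokernel of the preceding one, so [Phi] preserves it as a
    cokernel; exactness of the complex [zmap Phi Q] then makes [fmap Phi m] a monomorphism. The
    index n + 1 leaves room for the preceding differential. *)
Lemma fmap_image (Q : zsequence C) (n : int) (I : C) (m : hom I (Q (n + 1 + 1))) :
  preserves_cokernels -> zexact Q -> zexact (zmap Phi Q) ->
  is_image (zdiff Q (n + 1)) m ->
  is_image (fmap Phi (zdiff Q (n + 1))) (fmap Phi m).
Proof.
move=> hPhi eQ ePQ im; have [e [ee me]] := image_factor abC im.
have ce := exact_cokernel (eQ n) (image_mono im) ee me.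
have Pce := hPhi _ _ _ _ _ ce.
have Pme : fmap Phi m ∘ fmap Phi e = fmap Phi (zdiff Q (n + 1)).
  by rewrite -fmapM me.
apply: (image_epi_mono abD _ (cokernel_epi Pce) Pme).
exact: (exact_cokernel_mono (ePQ n) Pce Pme).
Qed.

Hypothesis gPhi : gorenstein_functor.

Lemma gorenstein_functor_gp (X : C) :
  gorenstein_projective X -> gorenstein_projective (Phi X).
Proof.
move=> [Q [I [m [cQ im [s hs]]]]]; have cPQ := gorenstein_complete gPhi cQ.
exists (zmap Phi Q), (Phi I), (fmap Phi m); split=> //.
  have [[_ eQ _] [_ ePQ _]] := (cQ, cPQ).
  (* [fmap_image] concerns the differential n + 1, so n = -2 gives the one leaving degree -1. *)
  exact: (@fmap_image Q (- 2) I m (gorenstein_cokernel gPhi) eQ ePQ im).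
by exists (fmap Phi s); apply: fmap_iso.
Qed.

(** The syzygy comes from a complete resolution of [Z]: [P] is its term in degree -1 and [K] the
    image of the differential leaving degree -2, so [fmap_image] keeps [k] mono. This takes the
    place of the vanishing of the first left derived functor of [Phi] at [Z]. *)
Lemma syzygy_mono (Z : C) : gorenstein_projective Z ->
  exists (K P : C) (k : hom K P) (e : hom P Z),
    [/\ projective P, epi e, is_kernel e k & mono (fmap Phi k)].
Proof.
move=> [Q [I [m [cQ im [s [s' [ss' s's]]]]]]].
have [[pQ eQ _] [_ ePQ _]] := (cQ, gorenstein_complete gPhi cQ).
have is' : is_iso s' by exists s.
have [e [ee me]] := image_factor abC im.
have [K [k ik]] := ab_image abC (zdiff Q (- 2)).
exists K, (Q (- 1)), k, (s' ∘ e); split.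
- exact: pQ.
- exact: epi_comp (iso_epi is') ee.
- apply/(mono_kernel_comp _ _ (iso_mono is')).
  apply/(mono_kernel_comp e k (image_mono im)); rewrite me.
  exact: (exact_image_kernel (eQ (- 2)) ik).
- apply: image_mono.
  exact: (@fmap_image Q (- 3) K k (gorenstein_cokernel gPhi) eQ ePQ ik).
Qed.

(* With K -> P -> Z a syzygy, X (+) P -> Y is an epimorphism with kernel K, so
   a generalized element of Phi X killed in Phi Y comes from Phi K; it vanishes
   because Phi K -> Phi P is a monomorphism. *)
Lemma gorenstein_short_exact (X Y Z : C) (i : hom X Y) (p : hom Y Z) :
  gorenstein_projective Z -> short_exact i p ->
  short_exact (fmap Phi i) (fmap Phi p).
Proof.
move=> gZ [ki cp]; apply: short_exactP; last exact: gorenstein_cokernel.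
have [K [P [k [e [pP ee ke mk]]]]] := syzygy_mono gZ.
have [t pt] := pP _ _ p e (cokernel_epi cp).
have [r ir] : exists r, i ∘ r = t ∘ k.
  by apply: (kernel_lift ki); rewrite compA pt ke.1.
have [_ /(_ X P) [S [i1 [i2 [p1 [p2 [e11 e22 e12 e21 e0]]]]]] _ _ _] := abC.
(* Since [i ∘ r = t ∘ k], the pair (r, -k) embeds [K] into X (+) P as the kernel of [s]. *)
pose s := i ∘ p1 + t ∘ p2; pose kap := i1 ∘ r - i2 ∘ k.
have si1 : s ∘ i1 = i by rewrite compDl -!compA e11 e21 compm0 compm1 addr0.
have si2 : s ∘ i2 = t by rewrite compDl -!compA e12 e22 compm0 compm1 add0r.
have p1k : p1 ∘ kap = r by rewrite compBr !compA e11 e12 comp0m comp1m subr0.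
have p2k : p2 ∘ kap = - k by rewrite compBr !compA e22 e21 comp0m comp1m sub0r.
have es : epi s.
  apply: epiP => T u us.
  have ui : u ∘ i = 0 by rewrite -si1 compA us comp0m.
  have [u' eu'] := cokernel_lift cp ui.
  suff u0 : u' = 0 by rewrite -eu' u0 comp0m.
  by apply: (epi0 ee); rewrite -pt compA eu' -si2 compA us comp0m.
have ks : is_kernel s kap.
  apply: is_kernelP.
  - by rewrite compBr !compA si1 si2 ir subrr.
  - apply: monoP => T u ku; apply: (mono0 (kernel_mono ke)).
    by apply: oppr_inj; rewrite oppr0 -compNl -p2k -compA ku compm0.
  move=> T w; rewrite compDl -!compA => /eqP; rewrite addrC addr_eq0 => /eqP sw.
  have [v kv] : exists v, k ∘ v = - (p2 ∘ w).
    apply: (kernel_lift ke).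
    by rewrite -pt -compA compNr sw opprK compA ki.1 comp0m.
  have rv : r ∘ v = p1 ∘ w.
    by apply: (kernel_mono ki); rewrite compA ir -compA kv compNr sw opprK.
  exists v; rewrite -[RHS]comp1m -e0 compBl compDl -!compA rv kv.
  by rewrite compNr opprK.
have [PS PE] := (exact_epi_cokernel abD _ _).2
  (gorenstein_cokernel gPhi (ab_epi abC es ks)).
apply: monoP => T w iw.
have [|T' [q [v [eq ev]]]] := exact_lift (t := fmap Phi i1 ∘ w) PS.
  by rewrite compA -fmapM si1.
have v0 : v = 0.
  apply: (mono0 mk); apply: oppr_inj; rewrite oppr0 -compNl -fmapN -p2k fmapM.
  by rewrite -compA ev !compA -fmapM e21 fmap0 !comp0m.
apply: (epi0 eq); rewrite -(comp1m w) -fmap1 -e11 fmapM -!compA.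
by rewrite (compA _ w) -ev v0 !compm0.
Qed.

Definition gorenstein_obj (X : stable_cat C) : stable_cat D :=
  GP (gorenstein_functor_gp (gpP X)).

Definition gorenstein_hom (X Y : stable_cat C) (f : hom X Y) :
    hom (gorenstein_obj X) (gorenstein_obj Y) :=
  stable_pi (X := gorenstein_obj X) (Y := gorenstein_obj Y)
    (fmap Phi (stable_repr f)).

(** The choice of representative is immaterial: [Phi] preserves projectives, hence factorizations
    through them. *)
Lemma gorenstein_homE (X Y : gp C) (f : hom (X : C) (Y : C)) :
  gorenstein_hom (stable_pi f) =
  stable_pi (X := gorenstein_obj X) (Y := gorenstein_obj Y) (fmap Phi f).
Proof.
have /stable_pi_eq [P [b [a [pP e]]]] := stable_reprK (stable_pi f).
apply/stable_pi_eq; exists (Phi P), (fmap Phi b), (fmap Phi a).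
by split; [exact: gorenstein_proj|rewrite -fmapM e fmapB].
Qed.

Lemma gorenstein_hom1 (X : stable_cat C) :
  gorenstein_hom (idm X) = idm (gorenstein_obj X).
Proof. by rewrite gorenstein_homE fmap1. Qed.

Lemma gorenstein_homM (X Y Z : stable_cat C) (g : hom Y Z) (f : hom X Y) :
  gorenstein_hom (g ∘ f) = gorenstein_hom g ∘ gorenstein_hom f.
Proof.
elim/stable_ind: g => g; elim/stable_ind: f => f.
by rewrite /= stable_compE !gorenstein_homE stable_compE fmapM.
Qed.

Lemma gorenstein_homD (X Y : stable_cat C) (f g : hom X Y) :
  gorenstein_hom (f + g) = gorenstein_hom f + gorenstein_hom g.
Proof.
elim/stable_ind: g => g; elim/stable_ind: f => f.
by rewrite -stable_piD !gorenstein_homE -stable_piD fmapD.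
Qed.

Definition stable_addfun : addfun (stable_cat C) (stable_cat D) :=
  AddFun gorenstein_hom1 gorenstein_homM gorenstein_homD.

(** * Compatibility with suspension and triangles *)

Section Shift.
Variable X : gp C.

Let Y : gp D := gorenstein_obj X.

(** A map of conflations over the identity of [Y], from the image under [Phi] of the chosen hull of
    [X] to the chosen hull of [Y]; its end [g] compares Phi(X[1]) with (Phi X)[1]. *)
Definition shift_comparison_pair
    (g : hom (Phi (hull_cok (hull_of X))) (hull_cok (hull_of Y) : D))
    (u : hom (Phi (hull_mid (hull_of X))) (hull_mid (hull_of Y))) :=
  u ∘ fmap Phi (hull_in (hull_of X)) = hull_in (hull_of Y) /\
  g ∘ fmap Phi (hull_out (hull_of X)) = hull_out (hull_of Y) ∘ u.

Lemma fmap_hull_exact :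
  short_exact (fmap Phi (hull_in (hull_of X))) (fmap Phi (hull_out (hull_of X))).
Proof. exact: gorenstein_short_exact (gpP _) (hull_exact _). Qed.

Lemma shift_comparison_exists : exists g u, shift_comparison_pair g u.
Proof.
have := @conflation_map D Y (gorenstein_obj (hull_cok (hull_of X))) Y _ _ _
  _ _ _ _ (idm _) fmap_hull_exact (hull_exact (hull_of Y)) (@hull_proj D _ (hull_of Y)).
by move=> [g [u [e1 e2]]]; exists g, u; split; rewrite ?e1 ?compm1.
Qed.

Definition shift_comparison :
    hom (gorenstein_obj (stable_shift C X)) (stable_shift D Y) :=
  @stable_pi D (gorenstein_obj (hull_cok (hull_of X))) (hull_cok (hull_of Y))
    (projT1 (cid shift_comparison_exists)).

Lemma shift_comparisonP : exists g u, shift_comparison_pair g u /\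
  shift_comparison =
  @stable_pi D (gorenstein_obj (hull_cok (hull_of X))) (hull_cok (hull_of Y)) g.
Proof. by rewrite /shift_comparison; case: cid => g /= [u h]; exists g, u. Qed.

(** Both conflations have projective middle terms, so comparison maps exist in both directions.
    Their composites lie over the identity and are stably the identity by
    [conflation_map_unique]. *)
Lemma shift_comparison_iso : is_iso shift_comparison.
Proof.
have [g [u [[e1 e2] ->]]] := shift_comparisonP.
have eX := fmap_hull_exact; have eY := hull_exact (hull_of Y).
have pX := gorenstein_proj gPhi (@hull_proj C _ (hull_of X)).
have pY := @hull_proj D _ (hull_of Y).
have [g' [u' [e1' e2']]] := @conflation_map D Y (hull_cok (hull_of Y)) Y
  _ _ _ _ _ _ _ (idm _) eY eX pX.
rewrite compm1 in e1'.
exists (@stable_pi D (hull_cok (hull_of Y)) (gorenstein_obj (hull_cok (hull_of X))) g').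
rewrite /= !stable_compE; split.
- apply: (conflation_map_unique (X := Y) (Y := Y) (f := idm (Y : D)) (f' := idm (Y : D))
    (X' := gorenstein_obj (hull_cok (hull_of X)))
    (Y' := gorenstein_obj (hull_cok (hull_of X)))
    (u := u' ∘ u) (g' := idm _) (u' := idm _) eX eX pX) => //.
  + by rewrite -compA e1 e1' compm1.
  + by rewrite -compA e2 !compA e2'.
  + by rewrite comp1m compm1.
  by rewrite comp1m compm1.
- apply: (conflation_map_unique (X := Y) (Y := Y) (f := idm (Y : D)) (f' := idm (Y : D))
    (X' := hull_cok (hull_of Y)) (Y' := hull_cok (hull_of Y))
    (u := u ∘ u') (g' := idm _) (u' := idm _) eY eY pY) => //.
  + by rewrite -compA e1' e1 compm1.
  + by rewrite -compA e2' !compA e2.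
  + by rewrite comp1m compm1.
  by rewrite comp1m compm1.
Qed.

End Shift.

(** Both composites end maps of conflations over [fmap Phi f], hence agree stably. *)
Lemma shift_comparison_natural (X Y : stable_cat C) (f : hom X Y) :
  shift_comparison Y ∘ fmap stable_addfun (fmap (stable_shift C) f) =
  fmap (stable_shift D) (fmap stable_addfun f) ∘ shift_comparison X.
Proof.
elim/stable_ind: f => f.
have [gX [uX [[eX eX'] ->]]] := shift_comparisonP X.
have [gY [uY [[eY eY'] ->]]] := shift_comparisonP Y.
have [g [u sp]] := shift_pair_exists f; have [e e'] := sp.
have [g' [u' sp']] := @shift_pair_exists D (gorenstein_obj X) (gorenstein_obj Y) (fmap Phi f).
have [d d'] := sp'.
rewrite /= (shift_homE sp) !gorenstein_homE (shift_homE sp') !stable_compE.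
apply: (conflation_map_unique (X := gorenstein_obj X) (Y := gorenstein_obj Y)
  (X' := gorenstein_obj (hull_cok (hull_of X)))
  (Y' := hull_cok (hull_of (gorenstein_obj Y))) (f := fmap Phi f) (f' := fmap Phi f)
  (u := uY ∘ fmap Phi u) (u' := u' ∘ uX) (fmap_hull_exact X)
  (hull_exact (hull_of (gorenstein_obj Y)))) => //.
- exact: (@hull_proj D).
- by rewrite -compA -fmapM e fmapM compA eY.
- by rewrite -compA -fmapM e' fmapM !compA eY'.
- by rewrite -compA eX.
- by rewrite -compA eX' !compA d'.
Qed.

Lemma stable_addfun_standard (X Y Z : stable_cat C) (u : hom X Y) (v : hom Y Z)
    (w : hom Z (stable_shift C X)) :
  standard_triangle u v w ->
  standard_triangle (fmap stable_addfun u) (fmap stable_addfun v)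
    (shift_comparison X ∘ fmap stable_addfun w).
Proof.
move=> [f [g [a [c [fg ea ec [-> -> ->]]]]]].
have [s [t [[e e'] ->]]] := shift_comparisonP X.
(* [t] maps the image of the hull of [X] to the chosen hull of its image, so [t ∘ fmap Phi a] is an
   extension as a standard triangle requires, and it induces [s ∘ fmap Phi c]. *)
exists (fmap Phi f), (fmap Phi g), (t ∘ fmap Phi a), (s ∘ fmap Phi c); split.
- exact: gorenstein_short_exact (gpP Z) fg.
- by rewrite -compA -fmapM ea e.
- by rewrite -compA -fmapM ec fmapM !compA e'.
by split; rewrite /= gorenstein_homE // stable_compE.
Qed.

Lemma stable_addfun_triangle (X Y Z : stable_cat C) (u : hom X Y) (v : hom Y Z)
    (w : hom Z (stable_shift C X)) :
  stable_triangle u v w ->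
  stable_triangle (fmap stable_addfun u) (fmap stable_addfun v)
    (shift_comparison X ∘ fmap stable_addfun w).
Proof.
move=> [X' [Y' [Z' [u' [v' [w' [x [y [z [st [ix iy iz] e1 e2 e3]]]]]]]]]].
exists (stable_addfun X'), (stable_addfun Y'), (stable_addfun Z').
exists (fmap stable_addfun u'), (fmap stable_addfun v').
exists (shift_comparison X' ∘ fmap stable_addfun w').
exists (fmap stable_addfun x), (fmap stable_addfun y), (fmap stable_addfun z).
split; first exact: stable_addfun_standard.
- by split; apply: fmap_iso.
- by rewrite -!fmapM e1.
- by rewrite -!fmapM e2.
- by rewrite compA -shift_comparison_natural -!compA -!fmapM e3.
Qed.

Definition stable_trifun : trifun (stable_gp C) (stable_gp D) :=
  @Trifun (stable_gp C) (stable_gp D) stable_addfun shift_comparison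
    shift_comparison_iso shift_comparison_natural stable_addfun_triangle.

End GorensteinFunctor.

(** * Descent of adjunctions to the stable categories *)

Section StableAdjunction.
Variables (C D : abcat) (L : addfun C D) (R : addfun D C).
Variables (gL : gorenstein_functor L) (gR : gorenstein_functor R).
Variable adj : adjunction L R.

Let sL := stable_addfun gL.
Let sR := stable_addfun gR.

Definition stable_unit (X : stable_cat C) : hom X (sR (sL X)) :=
  @stable_pi C X (sR (sL X)) (unit_of adj (gp_val X)).

Definition stable_counit (Y : stable_cat D) : hom (sL (sR Y)) Y :=
  @stable_pi D (sL (sR Y)) Y (counit_of adj (gp_val Y)).

Lemma stable_unit_natural (X X' : stable_cat C) (f : hom X X') :
  stable_unit X' ∘ f = fmap sR (fmap sL f) ∘ stable_unit X.
Proof.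
elim/stable_ind: f => f.
by rewrite /= !gorenstein_homE !stable_compE unit_natural.
Qed.

Lemma stable_counit_natural (Y Y' : stable_cat D) (g : hom Y Y') :
  stable_counit Y' ∘ fmap sL (fmap sR g) = g ∘ stable_counit Y.
Proof.
elim/stable_ind: g => g.
by rewrite /= !gorenstein_homE !stable_compE counit_natural.
Qed.

Lemma stable_counit_unit (X : stable_cat C) :
  stable_counit (sL X) ∘ fmap sL (stable_unit X) = idm (sL X).
Proof. by rewrite /= gorenstein_homE stable_compE counit_unit. Qed.

Lemma stable_unit_counit (Y : stable_cat D) :
  fmap sR (stable_counit Y) ∘ stable_unit (sR Y) = idm (sR Y).
Proof. by rewrite /= gorenstein_homE stable_compE unit_counit. Qed.

Definition stable_adjunction :
    adjunction (stable_trifun gL) (stable_trifun gR) :=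
  @Adjunction (stable_cat C) (stable_cat D) sL sR stable_unit stable_counit
    stable_unit_natural stable_counit_natural stable_counit_unit
    stable_unit_counit.

End StableAdjunction.

Lemma stable_pi_iso (C : abcat) (X Y : gp C) (f : hom (X : C) (Y : C)) :
  is_iso f -> @is_iso (stable_cat C) X Y (stable_pi f).
Proof.
move=> [g [e1 e2]]; exists (@stable_pi C Y X g).
by rewrite /= !stable_compE e1 e2.
Qed.

(** * The adjoint functors between A, B and the comma category *)

Section CommaFunctors.
Variables (A B : abcat) (F : addfun A B).
Implicit Types X Y Z : comma F.

Let abB := abcatP B.

Definition comma_mk (X : A) (Y : B) (phi : hom (F X) Y) : comma F := CommaObj phi.

Lemma zero_object_exists (C : abcat) : exists X : C, is_zero X.
Proof. by have [h _ _ _ _] := abcatP C. Qed.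

Definition zero_object (C : abcat) : C := projT1 (cid (zero_object_exists C)).

Lemma zero_objectP (C : abcat) : is_zero (zero_object C).
Proof. by rewrite /zero_object; case: cid. Qed.

Lemma from_zero (C : preadditive) (Z X : C) (f : hom Z X) : is_zero Z -> f = 0.
Proof. by move=> z; rewrite -(compm1 f) z compm0. Qed.

Lemma to_zero (C : preadditive) (Z X : C) (f : hom X Z) : is_zero Z -> f = 0.
Proof. by move=> z; rewrite -(comp1m f) z comp0m. Qed.

Definition comma_fst : addfun (comma F) A :=
  @AddFun (comma F) A (fun X => cfst X) (fun X Y f => hfst f)
    (fun X => erefl) (fun X Y Z g f => erefl) (fun X Y f g => erefl).

Definition comma_snd : addfun (comma F) B :=
  @AddFun (comma F) B (fun X => csnd X) (fun X Y f => hsnd f)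
    (fun X => erefl) (fun X Y Z g f => erefl) (fun X Y f g => erefl).

Lemma comma_diag_square (X Y : A) (f : hom X Y) :
  fmap F f ∘ idm (F X) = idm (F Y) ∘ fmap F f.
Proof. by rewrite comp1m compm1. Qed.

Definition comma_diag_hom (X Y : A) (f : hom X Y) :
    hom (comma_mk (idm (F X))) (comma_mk (idm (F Y))) :=
  @mk_comma A B F (comma_mk (idm (F X))) (comma_mk (idm (F Y))) _ _
    (comma_diag_square f).

Lemma comma_diag1 (X : A) : comma_diag_hom (idm X) = idm (comma_mk (idm (F X))).
Proof. by apply: comma_eq => //; apply: fmap1. Qed.

Lemma comma_diagM (X Y Z : A) (g : hom Y Z) (f : hom X Y) :
  comma_diag_hom (g ∘ f) = comma_diag_hom g ∘ comma_diag_hom f.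
Proof. by apply: comma_eq => //; apply: fmapM. Qed.

Lemma comma_diagD (X Y : A) (f g : hom X Y) :
  comma_diag_hom (f + g) = comma_diag_hom f + comma_diag_hom g.
Proof. by apply: comma_eq => //; apply: fmapD. Qed.

Definition comma_diag : addfun A (comma F) :=
  AddFun comma_diag1 comma_diagM comma_diagD.

Definition comma_right_obj (Y : B) : comma F :=
  comma_mk (0 : hom (F (zero_object A)) Y).

Lemma comma_right_square (X : comma F) (Y : B) (f : hom Y (csnd X)) :
  f ∘ (0 : hom (F (zero_object A)) Y) =
  cmap X ∘ fmap F (0 : hom (zero_object A) (cfst X)).
Proof. by rewrite fmap0 !compm0. Qed.

(** With an arbitrary target [X] this is the transpose of [f] under (0, -) -| snd; it yields both
    the action of (0, -) on morphisms and the counit of [right_snd_adj]. *)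
Definition comma_right_map (X : comma F) (Y : B) (f : hom Y (csnd X)) :
    hom (comma_right_obj Y) X :=
  @mk_comma A B F (comma_right_obj Y) X _ _ (comma_right_square f).

Lemma comma_right1 (Y : B) :
  @comma_right_map (comma_right_obj Y) Y (idm Y) = idm (comma_right_obj Y).
Proof. by apply: comma_eq => //; apply/esym/zero_objectP. Qed.

Lemma comma_rightM (X Y Z : B) (g : hom Y Z) (f : hom X Y) :
  @comma_right_map (comma_right_obj Z) X (g ∘ f) =
  @comma_right_map (comma_right_obj Z) Y g ∘ @comma_right_map (comma_right_obj Y) X f.
Proof. by apply: comma_eq => //; apply/esym/comp0m. Qed.

Lemma comma_rightD (X Y : B) (f g : hom X Y) :
  @comma_right_map (comma_right_obj Y) X (f + g) =
  @comma_right_map (comma_right_obj Y) X f + @comma_right_map (comma_right_obj Y) X g.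
Proof. by apply: comma_eq => //; apply/esym/addr0. Qed.

Definition comma_right : addfun B (comma F) :=
  @AddFun B (comma F) comma_right_obj
    (fun U V f => @comma_right_map (comma_right_obj V) U f)
    comma_right1 comma_rightM comma_rightD.

Definition comma_left_obj (X : A) : comma F :=
  comma_mk (0 : hom (F X) (zero_object B)).

Lemma comma_left_square (X : comma F) (Y : A) (f : hom (cfst X) Y) :
  (0 : hom (csnd X) (zero_object B)) ∘ cmap X =
  (0 : hom (F Y) (zero_object B)) ∘ fmap F f.
Proof. by rewrite !comp0m. Qed.

(** The transpose of [f] under fst -| (-, 0); it also supplies the unit of [fst_left_adj]. *)
Definition comma_left_map (X : comma F) (Y : A) (f : hom (cfst X) Y) :
    hom X (comma_left_obj Y) :=
  @mk_comma A B F X (comma_left_obj Y) _ _ (comma_left_square f).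

Lemma comma_left1 (X : A) :
  @comma_left_map (comma_left_obj X) X (idm X) = idm (comma_left_obj X).
Proof. by apply: comma_eq => //; apply/esym/zero_objectP. Qed.

Lemma comma_leftM (X Y Z : A) (g : hom Y Z) (f : hom X Y) :
  @comma_left_map (comma_left_obj X) Z (g ∘ f) =
  @comma_left_map (comma_left_obj Y) Z g ∘ @comma_left_map (comma_left_obj X) Y f.
Proof. by apply: comma_eq => //; apply/esym/comp0m. Qed.

Lemma comma_leftD (X Y : A) (f g : hom X Y) :
  @comma_left_map (comma_left_obj X) Y (f + g) =
  @comma_left_map (comma_left_obj X) Y f + @comma_left_map (comma_left_obj X) Y g.
Proof. by apply: comma_eq => //; apply/esym/addr0. Qed.

Definition comma_left : addfun A (comma F) :=
  @AddFun A (comma F) comma_left_obj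
    (fun U V f => @comma_left_map (comma_left_obj U) V f)
    comma_left1 comma_leftM comma_leftD.

Definition coker_obj X : B := projT1 (cid (ab_cokernel abB (cmap X))).

Definition coker_map X : hom (csnd X) (coker_obj X) :=
  projT1 (cid (projT2 (cid (ab_cokernel abB (cmap X))))).

Lemma coker_mapP X : is_cokernel (cmap X) (coker_map X).
Proof. exact: (projT2 (cid (projT2 (cid (ab_cokernel abB (cmap X)))))). Qed.

Lemma coker_hom_exists X Y (f : hom X Y) :
  exists g, g ∘ coker_map X = coker_map Y ∘ hsnd f.
Proof.
apply: (cokernel_lift (coker_mapP X)).
by rewrite -compA comma_sq compA (coker_mapP Y).1 comp0m.
Qed.

Definition coker_hom X Y (f : hom X Y) : hom (coker_obj X) (coker_obj Y) :=
  projT1 (cid (coker_hom_exists f)).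

Lemma coker_homE X Y (f : hom X Y) :
  coker_hom f ∘ coker_map X = coker_map Y ∘ hsnd f.
Proof. by rewrite /coker_hom; case: cid. Qed.

Lemma coker_map_eq X (T : B) (f g : hom (coker_obj X) T) :
  f ∘ coker_map X = g ∘ coker_map X -> f = g.
Proof. exact: (cokernel_epi (coker_mapP X)). Qed.

Lemma coker_hom1 X : coker_hom (idm X) = idm (coker_obj X).
Proof. by apply: coker_map_eq; rewrite coker_homE comp1m compm1. Qed.

Lemma coker_homM X Y Z (g : hom Y Z) (f : hom X Y) :
  coker_hom (g ∘ f) = coker_hom g ∘ coker_hom f.
Proof.
apply: coker_map_eq.
by rewrite coker_homE -compA coker_homE !compA coker_homE.
Qed.

Lemma coker_homD X Y (f g : hom X Y) :
  coker_hom (f + g) = coker_hom f + coker_hom g.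
Proof. by apply: coker_map_eq; rewrite compDl !coker_homE -compDr. Qed.

Definition comma_coker : addfun (comma F) B :=
  AddFun coker_hom1 coker_homM coker_homD.

Lemma diag_counit_square X : cmap X ∘ idm _ = cmap X ∘ fmap F (idm (cfst X)).
Proof. by rewrite fmap1. Qed.

(** The pair (1, phi) from (A, FA) to (A, B), which becomes the first map of the recollement
    triangle. *)
Definition diag_counit X : hom (comma_diag (comma_fst X)) X :=
  @mk_comma A B F (comma_diag (cfst X)) X _ _ (diag_counit_square X).

Lemma diag_fst_natural X Y (g : hom X Y) :
  diag_counit Y ∘ fmap comma_diag (fmap comma_fst g) = g ∘ diag_counit X.
Proof.
apply: comma_eq; first exact: etrans (comp1m _) (esym (compm1 _)).
exact: esym (comma_sq _).
Qed.

Definition diag_fst_adj : adjunction comma_diag comma_fst.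
Proof.
refine (@Adjunction A (comma F) comma_diag comma_fst (fun U => idm U) diag_counit
  _ diag_fst_natural _ _).
- by move=> X X' f; rewrite comp1m compm1.
- move=> X; apply: comma_eq; first exact: comp1m.
  by apply: etrans (comp1m _) _; apply: fmap1.
- by move=> Y; rewrite /= comp1m.
Defined.

Definition fst_left_adj : adjunction comma_fst comma_left.
Proof.
refine (@Adjunction (comma F) A comma_fst comma_left
  (fun X => @comma_left_map X _ (idm (cfst X))) (fun U => idm U) _ _ _ _).
- move=> X X' f; apply: comma_eq; first exact: etrans (comp1m _) (esym (compm1 _)).
  exact: etrans (comp0m _ _) (esym (comp0m _ _)).
- by move=> X X' f; rewrite comp1m compm1.
- by move=> X; rewrite /= comp1m.
- move=> X; apply: comma_eq; first exact: comp1m.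
  exact: etrans (comp0m _ _) (esym (zero_objectP _)).
Defined.

Definition right_snd_adj : adjunction comma_right comma_snd.
Proof.
refine (@Adjunction B (comma F) comma_right comma_snd (fun U => idm U)
  (fun X => comma_right_map (idm (csnd X))) _ _ _ _).
- by move=> X X' f; rewrite comp1m compm1.
- move=> X X' f; apply: comma_eq; first exact: etrans (comp0m _ _) (esym (compm0 _ _)).
  exact: etrans (comp1m _) (esym (compm1 _)).
- move=> X; apply: comma_eq; last exact: comp1m.
  exact: etrans (comp0m _ _) (esym (zero_objectP _)).
- by move=> X; rewrite /= comp1m.
Defined.

Lemma coker_unit_square X :
  coker_map X ∘ cmap X =
  (0 : hom (F (zero_object A)) _) ∘ fmap F (0 : hom (cfst X) _).
Proof. by rewrite comp0m (coker_mapP X).1. Qed.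

(** The pair consisting of 0 and the projection onto Coker phi, which becomes the second map of the
    recollement triangle. *)
Definition coker_unit X : hom X (comma_right (comma_coker X)) :=
  @mk_comma A B F X (comma_right_obj (coker_obj X)) _ _ (coker_unit_square X).

Lemma coker_counit_exists (Y : B) :
  exists g, g ∘ coker_map (comma_right Y) = idm Y.
Proof. by apply: (cokernel_lift (coker_mapP _)); rewrite /= compm0. Qed.

Definition coker_counit (Y : B) : hom (comma_coker (comma_right Y)) Y :=
  projT1 (cid (coker_counit_exists Y)).

Lemma coker_counitE (Y : B) :
  coker_counit Y ∘ coker_map (comma_right Y) = idm Y.
Proof. by rewrite /coker_counit; case: cid. Qed.

(** The structure morphism of (0, Y) is zero, so its cokernel is [Y]. This yields the full
    faithfulness of i_*. *)
Lemma coker_counit_iso (Y : B) : is_iso (coker_counit Y).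
Proof.
exists (coker_map (comma_right Y)); split; last exact: coker_counitE.
by apply: coker_map_eq; rewrite -compA coker_counitE comp1m compm1.
Qed.

Definition coker_right_adj : adjunction comma_coker comma_right.
Proof.
refine (@Adjunction (comma F) B comma_coker comma_right coker_unit coker_counit
  _ _ _ _).
- move=> X X' f; apply: comma_eq; first exact: etrans (comp0m _ _) (esym (comp0m _ _)).
  exact: esym (coker_homE _).
- move=> Y Y' g; apply: coker_map_eq.
  rewrite -!compA coker_homE coker_counitE compm1 /=.
  by rewrite compA coker_counitE comp1m.
- move=> X; apply: coker_map_eq.
  by rewrite -compA coker_homE comp1m compA coker_counitE comp1m.
- move=> Y; apply: comma_eq; last exact: coker_counitE.
  exact: etrans (comp0m _ _) (esym (zero_objectP _)).
Defined.

End CommaFunctors.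

(** * Exactness and projectives in the comma category *)

Section CommaGorenstein.
Variables (A B : abcat) (F : addfun A B).
Variable rF : right_exact F.
Implicit Types X Y Z T : comma F.

Let abB := abcatP B.

Lemma epi_of_components X Y (f : hom X Y) :
  epi (hfst f) -> epi (hsnd f) -> epi f.
Proof.
move=> e1 e2 T u v e; apply: comma_eq.
  exact: (e1 _ _ _ (congr1 (@hfst _ _ F _ _) e)).
exact: (e2 _ _ _ (congr1 (@hsnd _ _ F _ _) e)).
Qed.

Lemma epi_from_zero (C : preadditive) (Z X : C) (f : hom X Z) :
  is_zero Z -> epi f.
Proof. by move=> z T u v _; rewrite (from_zero u z) (from_zero v z). Qed.

Lemma comma_kernel_components X Y K (f : hom X Y) (k : hom K X) :
  is_kernel f k -> is_kernel (hfst f) (hfst k) /\ is_kernel (hsnd f) (hsnd k).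
Proof.
move=> kk; have [K' [k' [ka kb]]] := comma_kernel f.
have [s [is_s <-]] := kernel_unique kk (comma_kernelP ka kb).
split.
  exact: (kernel_iso (fmap_iso (comma_fst F) is_s) ka).
exact: (kernel_iso (fmap_iso (comma_snd F) is_s) kb).
Qed.

(** Kernels and cokernels, hence images, are computed componentwise; right exactness of [F] enters
    through the cokernels. *)
Lemma comma_exactP X Y Z (f : hom X Y) (g : hom Y Z) :
  exact f g <-> exact (hfst f) (hfst g) /\ exact (hsnd f) (hsnd g).
Proof.
have [K [c [ca cb]]] := comma_cokernel rF f.
have [I [m [ma mb]]] := comma_kernel c.
have im : is_image f m.
  by exists K, c; split; [exact: comma_cokernelP|exact: comma_kernelP].
have ima : is_image (hfst f) (hfst m) by exists (cfst K), (hfst c).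
have imb : is_image (hsnd f) (hsnd m) by exists (csnd K), (hsnd c).
split=> [ex|[exa exb]].
  have [ka kb] := comma_kernel_components (exact_image_kernel ex im).
  by split; [exists (cfst I), (hfst m)|exists (csnd I), (hsnd m)].
exists I, m; split=> //; apply: comma_kernelP.
  exact: exact_image_kernel exa ima.
exact: exact_image_kernel exb imb.
Qed.

Lemma comma_zexact (Q : zsequence (comma F)) :
  zexact (zmap (comma_fst F) Q) -> zexact (zmap (comma_snd F) Q) -> zexact Q.
Proof. by move=> e1 e2 n; apply/comma_exactP; split; [apply: e1|apply: e2]. Qed.

Lemma fst_zexact (Q : zsequence (comma F)) :
  zexact Q -> zexact (zmap (comma_fst F) Q).
Proof. by move=> eQ n; have /comma_exactP [] := eQ n. Qed.

Lemma snd_zexact (Q : zsequence (comma F)) :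
  zexact Q -> zexact (zmap (comma_snd F) Q).
Proof. by move=> eQ n; have /comma_exactP [] := eQ n. Qed.

(** This and the next three lemmas hold because the functor has a right adjoint preserving
    epimorphisms: (-, 0), (0, -), fst and snd respectively. *)
Lemma fst_projective T : projective T -> projective (cfst T).
Proof.
apply: (left_adjoint_projective (fst_left_adj F)) => X Y e ee.
by apply: epi_of_components => //; apply: epi_from_zero; apply: zero_objectP.
Qed.

Lemma coker_projective T : projective T -> projective (coker_obj T).
Proof.
apply: (left_adjoint_projective (coker_right_adj F)) => X Y e ee.
by apply: epi_of_components => //; apply: epi_from_zero; apply: zero_objectP.
Qed.

Lemma diag_projective (P : A) : projective P -> projective (comma_diag F P).
Proof.
apply: (left_adjoint_projective (diag_fst_adj F)) => X Y e ee.
by have [] := comma_epi rF ee.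
Qed.

Lemma right_projective (P : B) : projective P -> projective (comma_right F P).
Proof.
apply: (left_adjoint_projective (right_snd_adj F)) => X Y e ee.
by have [] := comma_epi rF ee.
Qed.

(* A projective T is a retract of diag (cfst T) (+) (0, csnd T), and the
   structure morphism of the latter is a split monomorphism. *)
Lemma projective_cmap_retraction T : projective T ->
  exists r, r ∘ cmap T = idm (F (cfst T)).
Proof.
move=> pT.
have [S [i1 [i2 [p1 [p2 [e11 e22 e12 e21 _]]]]]] :=
  comma_biproduct (comma_diag F (cfst T)) (comma_right F (csnd T)).
pose e := diag_counit T ∘ p1 + comma_right_map (X := T) (idm (csnd T)) ∘ p2.
have ei1 : e ∘ i1 = diag_counit T.
  by rewrite compDl -!compA e11 e21 compm0 compm1 addr0.
have ei2 : e ∘ i2 = comma_right_map (X := T) (idm (csnd T)).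
  by rewrite compDl -!compA e12 e22 compm0 compm1 add0r.
(* The components of [e] are split by [hfst i1] and [hsnd i2]. *)
have ee : epi e.
  apply: epi_of_components => W u v uv.
    have := congr1 (fun h => h ∘ hfst i1) uv.
    rewrite -!compA (_ : hfst e ∘ hfst i1 = idm _) ?compm1 //.
    exact: (congr1 (@hfst _ _ F _ _) ei1).
  have := congr1 (fun h => h ∘ hsnd i2) uv.
  rewrite -!compA (_ : hsnd e ∘ hsnd i2 = idm _) ?compm1 //.
  exact: (congr1 (@hsnd _ _ F _ _) ei2).
have [s es] := pT _ _ e (idm T) ee.
(* This is the second component of [p1 ∘ s], a morphism from [T] to (A, FA). Its first component is
   the identity, because [hfst p1] equals [hfst e] and [s] is a section of [e]. *)
exists (hsnd p1 ∘ hsnd s).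
have sqs : hsnd s ∘ cmap T = cmap S ∘ fmap F (hfst s) := comma_sq s.
have sqp : hsnd p1 ∘ cmap S = idm _ ∘ fmap F (hfst p1) := comma_sq p1.
have h1 : hfst e ∘ hfst s = idm (cfst T) := congr1 (@hfst _ _ F _ _) es.
rewrite -compA sqs compA sqp comp1m -fmapM.
have -> : hfst p1 ∘ hfst s = idm (cfst T); last exact: fmap1.
rewrite -h1; congr (_ ∘ _).
transitivity (idm (cfst T) ∘ hfst p1 + 0 ∘ hfst p2); last by [].
by rewrite comp1m comp0m addr0.
Qed.

Lemma projective_cmap_mono T : projective T -> mono (cmap T).
Proof.
move=> /projective_cmap_retraction [r e] W u v uv.
by rewrite -(comp1m u) -(comp1m v) -e -!compA uv.
Qed.

(** The retraction of [cmap T] splits [csnd T] as F(cfst T) (+) Coker, so that (P2) can handle the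
    first summand. *)
Lemma projective_biproduct_coker T : projective T ->
  exists i p, is_biproduct (cmap T) i p (coker_map T).
Proof.
move=> pT; have [r er] := projective_cmap_retraction pT.
have cc := coker_mapP T.
have [i ei] : exists i, i ∘ coker_map T = idm _ - cmap T ∘ r.
  by apply: (cokernel_lift cc); rewrite compBl comp1m -compA er compm1 subrr.
exists i, r; split=> //.
- apply: coker_map_eq; rewrite -compA ei compBr compm1 compA cc.1.
  by rewrite comp0m subr0 comp1m.
- apply: coker_map_eq; rewrite -compA ei compBr compm1 compA er comp1m.
  by rewrite subrr comp0m.
- by case: cc.
- by rewrite ei addrC subrK.
Qed.

(** As each [cmap (Q n)] is mono, F(fst Q) -> snd Q -> Coker Q is a short exact sequence of
    complexes. The first two are exact, hence so is the third. *)
Lemma coker_zexact (Q : zsequence (comma F)) :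
  zprojective Q -> zexact Q -> zexact (zmap F (zmap (comma_fst F) Q)) ->
  zexact (zmap (comma_coker F) Q).
Proof.
move=> pQ eQ eF n.
have sq m : hsnd (zdiff Q m) ∘ cmap (Q m) =
  cmap (Q (m + 1)) ∘ fmap F (hfst (zdiff Q m)) := comma_sq _.
have csq m : coker_hom (zdiff Q m) ∘ coker_map (Q m) =
  coker_map (Q (m + 1)) ∘ hsnd (zdiff Q m) := coker_homE _.
have mQ m := projective_cmap_mono (pQ m).
have kQ m := ab_mono abB (mQ m) (coker_mapP (Q m)).
have eS := snd_zexact eQ.
apply: exactP => [|T t dt].
  rewrite /= -coker_homM (exact0 (eQ n)).
  by apply: coker_map_eq; rewrite coker_homE comp0m compm0.
(* Up to epimorphic covers, the cycle [t] lifts to [b] in snd Q; the differential of [b] comes from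
   a cycle [x] of F(fst Q), which is the boundary of some [y]; then [b] minus the image of [y] is a
   cycle, hence the boundary of [z]. *)
have [T1 [q1 [b [eq1 eb]]]] := epi_lift t (cokernel_epi (coker_mapP (Q (n + 1)))).
have [x ex] : exists x, cmap (Q (n + 1 + 1)) ∘ x = hsnd (zdiff Q (n + 1)) ∘ b.
  apply: (kernel_lift (kQ _)).
  by rewrite compA -csq -compA eb compA dt comp0m.
have dx : fmap F (hfst (zdiff Q (n + 1 + 1))) ∘ x = 0.
  apply: (mono0 (mQ _)); rewrite compA -sq -compA ex compA.
  by rewrite (exact0 (eS (n + 1))) comp0m.
have [T2 [q2 [y [eq2 ey]]]] := exact_lift (eF (n + 1)) dx.
have dz : hsnd (zdiff Q (n + 1)) ∘ (b ∘ q2 - cmap (Q (n + 1)) ∘ y) = 0.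
  by rewrite compBr !compA sq -ex -!compA ey subrr.
have [T3 [q3 [z [eq3 ez]]]] := exact_lift (eS n) dz.
exists T3, (q1 ∘ q2 ∘ q3), (coker_map (Q n) ∘ z); split.
  exact: epi_comp (epi_comp eq1 eq2) eq3.
rewrite /= compA csq -compA [hsnd _ ∘ z]ez compBl compBr !compA.
by rewrite (coker_mapP _).1 !comp0m subr0 eb.
Qed.

(** * Consequences of perfectness: the four functors and the canonical conflation *)

Variable pF : perfect F.

(** (P1) for fst Q gives exactness of Coker Q, and Hom(Coker Q, P) is Hom(Q, (0, P)) with (0, P)
    projective. *)
Lemma coker_gorenstein : @gorenstein_functor (comma_ab rF) B (comma_coker F).
Proof.
split; last exact: coker_projective.
  move=> X Y K f c; exact: (left_adjoint_cokernel (coker_right_adj F)).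
move=> Q [pQ eQ hQ]; split.
- by move=> n; apply: coker_projective.
- apply: coker_zexact => //; apply: pF.1; last exact: fst_zexact.
  by move=> n; apply: fst_projective.
move=> P pP; apply/(adj_hom_exact (coker_right_adj F)); apply: hQ.
exact: right_projective.
Qed.

(** Hom((0, Q), T) is Hom(Q, csnd T). For projective [T] the target splits as F(cfst T) (+) Coker:
    (P2) treats the first summand, and the second is projective. *)
Lemma right_gorenstein : @gorenstein_functor B (comma_ab rF) (comma_right F).
Proof.
split; last exact: right_projective.
  move=> X Y K f c; exact: (left_adjoint_cokernel (right_snd_adj F)).
move=> Q cQ; have [pQ eQ hQ] := cQ; split.
- by move=> n; apply: right_projective.
- apply: comma_zexact; last exact: eQ.
  move=> n; apply: exactP => [|T t _]; first by rewrite comp0m.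
  exists T, (idm T), 0; split; first by move=> W u v; rewrite !compm1.
  by apply: etrans (to_zero _ (zero_objectP A)) (esym (to_zero _ (zero_objectP A))).
move=> T pT; apply/(adj_hom_exact (right_snd_adj F)).
have [i [p bp]] := projective_biproduct_coker pT.
apply: (hom_exact_biproduct bp) => //; last exact: hQ (coker_projective pT).
by apply: pF.2 cQ (fst_projective pT).
Qed.

Lemma diag_gorenstein : @gorenstein_functor A (comma_ab rF) (comma_diag F).
Proof.
split; last exact: diag_projective.
  move=> X Y K f c; exact: (left_adjoint_cokernel (diag_fst_adj F)).
move=> Q [pQ eQ hQ]; split.
- by move=> n; apply: diag_projective.
- by apply: comma_zexact; [exact: eQ|exact: pF.1].
move=> T pT; apply/(adj_hom_exact (diag_fst_adj F)).
exact: hQ (fst_projective pT).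
Qed.

(** Reduces Hom exactness into (X, 0) to the same property for (0, FX) and (X, FX), by
    [hom_exact_quotient]. *)
Lemma diag_left_short_exact (X : A) :
  @short_exact (comma F) (comma_right F (F X)) (comma_diag F X) (comma_left F X)
    (comma_right_map (X := comma_diag F X) (idm (F X)))
    (comma_left_map (X := comma_diag F X) (idm X)).
Proof.
have zA := zero_objectP A; have zB := zero_objectP B.
split.
  apply: comma_kernelP; apply: is_kernelP => /=.
  - exact: compm0.
  - by move=> T u v _; rewrite (to_zero u zA) (to_zero v zA).
  - by move=> T t; rewrite comp1m => ->; exists 0; rewrite comp0m.
  - exact: comp0m.
  - by move=> T u v; rewrite !comp1m.
  - by move=> T t _; exists t; rewrite comp1m.
apply: (comma_cokernelP rF); apply: is_cokernelP => /=.
- exact: compm0.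
- by move=> T u v; rewrite !compm1.
- by move=> T t _; exists t; rewrite compm1.
- exact: comp0m.
- by move=> T u v _; rewrite (from_zero u zB) (from_zero v zB).
- by move=> T t; rewrite compm1 => ->; exists 0; rewrite comp0m.
Qed.

(** Hom(fst Q, P) is Hom(Q, (P, 0)), and (P, 0) is the quotient of (P, FP) by (0, FP). The former is
    projective; for the latter, Hom(Q, (0, FP)) is Hom(Coker Q, FP), exact by (P2) because Coker Q
    is a complete resolution. *)
Lemma fst_gorenstein : @gorenstein_functor (comma_ab rF) A (comma_fst F).
Proof.
split; last exact: fst_projective.
  move=> X Y K f c; exact: (left_adjoint_cokernel (fst_left_adj F)).
move=> Q cQ; have [pQ eQ hQ] := cQ; split.
- by move=> n; apply: fst_projective.
- exact: fst_zexact.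
move=> P pP; apply/(adj_hom_exact (fst_left_adj F)).
apply: (hom_exact_quotient (diag_left_short_exact P)) => //.
  apply/(adj_hom_exact (coker_right_adj F)).
  by apply: pF.2 pP; apply: gorenstein_complete coker_gorenstein _ cQ.
exact: hQ (diag_projective pP).
Qed.

(** Embed [T], up to isomorphism, in a projective term of its complete resolution by [m]. The
    structure morphism of that term is mono, and so is [F] of the first component of [m]; the
    commuting square gives the claim. *)
Lemma gorenstein_cmap_mono T :
  @gorenstein_projective (comma_ab rF) T -> mono (cmap T).
Proof.
move=> [Q [I [m [cQ im [s hs]]]]]; have [pQ eQ _] := cQ.
have [pf ef _] := gorenstein_complete fst_gorenstein cQ.
have imf : is_image (hfst (zdiff Q (- 1))) (hfst m).
  exact: (@fmap_image (comma_ab rF) A (comma_fst F) Q (- 2) I m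
    (gorenstein_cokernel fst_gorenstein) eQ ef im).
have mI : mono (cmap I).
  have mm : mono (hsnd m ∘ cmap I).
    rewrite comma_sq; apply: mono_comp; first exact: projective_cmap_mono.
    apply: image_mono.
    (* Here [fmap_image] is applied to [F] itself: right exactness preserves cokernels, and (P1)
       keeps the complex fst Q exact under [F]. *)
    exact: (@fmap_image A B F (zmap (comma_fst F) Q) (- 2) _ (hfst m)
      (@right_exact_cokernel A B F rF) ef (pF.1 _ pf ef) imf).
  by move=> W u v uv; apply: mm; rewrite -!compA uv.
have ms : mono (hsnd s ∘ cmap T).
  rewrite comma_sq; apply: mono_comp mI _; apply: iso_mono.
  exact: fmap_iso (fmap_iso (comma_fst F) hs).
by move=> W u v uv; apply: ms; rewrite -!compA uv.
Qed.

(** The first components form A = A -> 0, the second FA -> B -> Coker phi. *)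
Lemma comma_short_exact T : mono (cmap T) ->
  short_exact (diag_counit T) (coker_unit T).
Proof.
move=> mT; have zA := zero_objectP A; have cT := coker_mapP T.
split.
  apply: comma_kernelP; last exact: (ab_mono abB mT cT).
  apply: is_kernelP => /=.
  - exact: comp0m.
  - by move=> W u v; rewrite !comp1m.
  - by move=> W t _; exists t; rewrite comp1m.
apply: (comma_cokernelP rF); last exact: cT.
apply: is_cokernelP => /=.
- exact: comp0m.
- by move=> W u v _; rewrite (from_zero u zA) (from_zero v zA).
- by move=> W t; rewrite compm1 => ->; exists 0; rewrite comp0m.
Qed.

End CommaGorenstein.

(** * Assembly of the left recollement *)

Theorem theorem1p2 (A B : abcat) (F : addfun A B) (rF : right_exact F)
    (pF : perfect F) :
  exists (i_up : trifun (stable_gp (comma_ab rF)) (stable_gp B))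
         (i_low : trifun (stable_gp B) (stable_gp (comma_ab rF)))
         (j_low : trifun (stable_gp A) (stable_gp (comma_ab rF)))
         (j_up : trifun (stable_gp (comma_ab rF)) (stable_gp A)),
    left_recollement i_up i_low j_low j_up.
Proof.
have gc := coker_gorenstein rF pF; have gr := right_gorenstein rF pF.
have gd := diag_gorenstein rF pF; have gf := fst_gorenstein rF pF.
exists (stable_trifun gc), (stable_trifun gr), (stable_trifun gd), (stable_trifun gf).
pose adi := stable_adjunction gc gr (coker_right_adj F).
pose adj := stable_adjunction gd gf (diag_fst_adj F).
exists adi, adj; split.
- split.
    apply: (right_adjoint_fully_faithful (adj := adi)) => Y.
    by apply: stable_pi_iso; apply: coker_counit_iso.
  apply: (left_adjoint_fully_faithful (adj := adj)) => X.
  by apply: stable_pi_iso; exists (idm (X : A)); rewrite comp1m.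
- move=> X; rewrite /is_zero /= /stable_id.
  by rewrite (_ : idm _ = 0); [exact: raddf0|exact: zero_objectP].
move=> X.
pose T : comma_ab rF := gp_val X.
pose dX := gorenstein_obj gd (gorenstein_obj gf X).
pose rX := gorenstein_obj gr (gorenstein_obj gc X).
have sT : @short_exact (comma_ab rF) dX T rX (diag_counit T) (coker_unit T).
  apply: (comma_short_exact rF); apply: (gorenstein_cmap_mono pF); exact: (gpP X).
have hd := hull_exact (hull_of dX).
(* The third map of the triangle: [hull_in] of (A, FA) extends along the canonical conflation, and
   the extension induces [c] on cokernels. *)
have [a ea] := conflation_extend (hull_in (hull_of dX)) sT (gpP rX)
  (@hull_proj _ _ (hull_of dX)).
have [c ec] : exists c, c ∘ coker_unit T = hull_out (hull_of dX) ∘ a.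
  by apply: (cokernel_lift sT.2); rewrite -compA ea hd.1.1.
exists (stable_pi (X := rX) (Y := shift_obj dX) c).
(* The triangle is already standard, so identities serve as the comparison isomorphisms. *)
exists dX, X, rX, (counit_of adj X), (unit_of adi X).
exists (stable_pi (X := rX) (Y := shift_obj dX) c).
exists (idm dX), (idm X), (idm rX); split.
- by exists (diag_counit T), (coker_unit T), a, c; split.
- by split; exists (idm _); rewrite comp1m.
- by rewrite comp1m compm1.
- by rewrite comp1m compm1.
- by rewrite fmap1 comp1m compm1.
Qed.
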